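(* Let $2 \leq p < \infty$. If some $L^p$ space (i.e. $L^p(\Omega,\mu)$ for some measure space $(\Omega,\mu)$) whose dimension is at least $2$ has a computable presentation, then $p$ is a computable real number.
   Context: The scalar field $\mathbb{F}$ is $\mathbb{R}$ or $\mathbb{C}$, and $\mathbb{F}_{\mathbb{Q}} = \mathbb{F} \cap \mathbb{Q}(i)$ denotes the rational scalars. A presentation of a Banach space $\mathcal{B}$ is a pair $\mathcal{B}^\# = (\mathcal{B}, (v_n)_{n \in \mathbb{N}})$ where $(v_n)$ is a sequence of vectors of $\mathcal{B}$ whose linear span is dense in $\mathcal{B}$. The rational vectors of $\mathcal{B}^\#$ are the finite linear combinations $\sum_{j=0}^n \alpha_j v_j$ with $\alpha_j \in \mathbb{F}_{\mathbb{Q}}$. The presentation is computable if there is an algorithm that, given $k \in \mathbb{N}$ and a finite tuple $(\alpha_0,\dots,\alpha_n)$ of rational scalars, outputs a rational number $q$ with $|q - \|\sum_j \alpha_j v_j\|_{\mathcal{B}}| < 2^{-k}$. *)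

(* Defs.v *)
From HB Require Import structures.
From mathcomp Require Import all_boot all_order all_algebra.
From mathcomp Require Import complex.
From mathcomp Require Import all_classical all_reals all_analysis.
From mathcomp Require Import measurable_realfun.

Set Implicit Arguments.
Unset Strict Implicit.
Unset Printing Implicit Defensive.
Import Order.TTheory GRing.Theory Num.Theory.
Import numFieldNormedType.Exports.

Local Open Scope classical_set_scope.
Local Open Scope ring_scope.

(* Kleene's total recursive functions.  Minimization is applied only to
   functions that have a zero above every [x], so that all the functions
   considered are total. *)
Inductive recursive : forall n : nat, (n.-tuple nat -> nat) -> Prop :=
| recursive_zero (n : nat) : recursive (fun _ : n.-tuple nat => 0%N)
| recursive_succ : recursive (fun x : 1.-tuple nat => (thead x).+1)
| recursive_proj (n : nat) (i : 'I_n) :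
    recursive (fun x : n.-tuple nat => tnth x i)
| recursive_comp (m n : nat)
    (f : m.-tuple nat -> nat) (g : 'I_m -> n.-tuple nat -> nat) :
    recursive f -> (forall i, recursive (g i)) ->
    recursive (fun x : n.-tuple nat => f [tuple g i x | i < m])
| recursive_primrec (n : nat)
    (f : n.-tuple nat -> nat) (g : n.+2.-tuple nat -> nat) :
    recursive f -> recursive g ->
    recursive (fun x : n.+1.-tuple nat =>
      iteri (thead x) (fun k r => g [tuple of k :: r :: [tuple of behead x]])
            (f [tuple of behead x]))
| recursive_mu (n : nat) (f : n.+1.-tuple nat -> nat)
    (f0 : forall x : n.-tuple nat, exists y, f [tuple of y :: x] == 0%N) :
    recursive f -> recursive (fun x : n.-tuple nat => ex_minn (f0 x)).

Definition computable1 (f : nat -> nat) : Prop :=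
  recursive (fun x : 1.-tuple nat => f (tnth x ord0)).

Definition computable2 (f : nat -> nat -> nat) : Prop :=
  recursive (fun x : 2.-tuple nat => f (tnth x ord0) (tnth x ord_max)).

(* [CodeSeq.decode] is a bijection from [nat] to [seq nat]; the code of
   [:: a; b; c] names the rational (a - b) / (c + 1).  Names are not unique. *)
Definition rat_of_code (n : nat) : rat :=
  let s := CodeSeq.decode n in
  ((nth 0%N s 0)%:Z - (nth 0%N s 1)%:Z)%:Q / (nth 0%N s 2).+1%:R.

Lemma rat_of_code_surj (q : rat) : exists n, rat_of_code n = q.
Proof.
have [m mq] : exists m : nat, m.+1%:Z = denq q.
  by case: (denq q) (denq_gt0 q) => [[|m]|m] // _; exists m.
have [a [b abq]] : exists a b : nat, a%:Z - b%:Z = numq q.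
  case: (numq q) => k; first by exists k, 0%N; rewrite subr0.
  by exists 0%N, k.+1; rewrite sub0r NegzE.
exists (CodeSeq.code [:: a; b; m]); rewrite /rat_of_code CodeSeq.codeK /= abq.
by rewrite -[RHS]divq_num_den -mq -pmulrn.
Qed.

Definition computable_real (R : realType) (x : R) : Prop :=
  exists2 q : nat -> nat, computable1 q &
    forall k, `|ratr (rat_of_code (q k)) - x| < 2 ^- k.

Variant scalar_field := RealScalars | ComplexScalars.

Definition scalars (R : realType) (F : scalar_field) : numFieldType :=
  match F with RealScalars => R | ComplexScalars => R[i] end.

Section Scalars.
Variables (R : realType) (F : scalar_field).
Implicit Types z : scalars R F.

Definition of_real : R -> scalars R F :=
  match F return R -> scalars R F with
  | RealScalars => id
  | ComplexScalars => fun x => (x%:C)%C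
  end.

Definition sRe : scalars R F -> R :=
  match F return scalars R F -> R with
  | RealScalars => id
  | ComplexScalars => @complex.Re R
  end.

Definition sIm : scalars R F -> R :=
  match F return scalars R F -> R with
  | RealScalars => fun=> 0
  | ComplexScalars => @complex.Im R
  end.

(* The modulus as an element of [R]; the norm of [scalars R F] itself has
   values in [scalars R F]. *)
Definition modulus z : R := sRe `|z|.

(* The rational scalars are the [rational_scalar a b]: the rationals in the
   real case (where [b] is ignored), Q(i) in the complex case. *)
Definition rational_scalar (a b : rat) : scalars R F :=
  match F return scalars R F with
  | RealScalars => ratr a
  | ComplexScalars => (ratr a +i* ratr b)%C
  end.

Definition scalar_of_code (n : nat) : scalars R F :=
  let s := CodeSeq.decode n in
  rational_scalar (rat_of_code (nth 0%N s 0)) (rat_of_code (nth 0%N s 1)).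

Lemma scalar_of_code_surj (a b : rat) :
  exists n, scalar_of_code n = rational_scalar a b.
Proof.
have [m <-] := rat_of_code_surj a; have [n <-] := rat_of_code_surj b.
by exists (CodeSeq.code [:: m; n]); rewrite /scalar_of_code CodeSeq.codeK.
Qed.

Lemma of_real_modulus z : of_real (modulus z) = `|z|.
Proof. by rewrite /of_real /modulus /sRe; case: F z. Qed.

Lemma ler_of_real (x y : R) : (of_real x <= of_real y) = (x <= y).
Proof. by rewrite /of_real; case: F => //; exact: lecR. Qed.

Lemma of_real_inj : injective of_real.
Proof. by rewrite /of_real; case: F => // x y []. Qed.

Lemma of_realD (x y : R) : of_real (x + y) = of_real x + of_real y.
Proof. by rewrite /of_real; case: F => //; exact: raddfD. Qed.

Lemma of_realM (x y : R) : of_real (x * y) = of_real x * of_real y.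
Proof. by rewrite /of_real; case: F => //; exact: rmorphM. Qed.

Lemma of_real0 : of_real 0 = 0.
Proof. by rewrite /of_real; case: F. Qed.

Lemma modulusD z1 z2 : modulus (z1 + z2) <= modulus z1 + modulus z2.
Proof. by rewrite -ler_of_real of_realD !of_real_modulus ler_normD. Qed.

Lemma modulusM z1 z2 : modulus (z1 * z2) = modulus z1 * modulus z2.
Proof. by apply: of_real_inj; rewrite of_realM !of_real_modulus normrM. Qed.

Lemma modulus0 : modulus 0 = 0.
Proof. by apply: of_real_inj; rewrite of_real_modulus normr0 of_real0. Qed.

Lemma modulus_eq0 z : modulus z = 0 -> z = 0.
Proof.
by move=> z0; apply/eqP; rewrite -normr_eq0 -of_real_modulus z0 of_real0 eqxx.
Qed.

Lemma modulusE z : modulus z = Num.sqrt (sRe z ^+ 2 + sIm z ^+ 2).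
Proof.
rewrite /modulus /sRe /sIm; case: F z => z; last by rewrite normc_def.
by rewrite expr0n addr0 sqrtr_sqr.
Qed.

Lemma modulus_ge0 z : 0 <= modulus z.
Proof. by rewrite modulusE sqrtr_ge0. Qed.

End Scalars.

Section LpFunctions.
Context d (T : measurableType d) (R : realType).
Variables (F : scalar_field) (mu : {measure set T -> \bar R}) (p : R).
Local Notation K := (scalars R F).
Implicit Types f g : T -> K.

Definition smeasurable f : Prop :=
  measurable_fun setT (@sRe R F \o f) /\ measurable_fun setT (@sIm R F \o f).

Definition sLnorm f : \bar R := 'N[mu]_p%:E[EFin \o (@modulus R F \o f)]%E.

Definition Lp_function f : Prop := smeasurable f /\ (sLnorm f < +oo)%E.

Lemma smeasurable_modulus f :
  smeasurable f -> measurable_fun setT (@modulus R F \o f).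
Proof.
move=> [mr mi]; rewrite (_ : _ \o _ = fun x =>
  (((@sRe R F \o f) x) ^+ 2 + ((@sIm R F \o f) x) ^+ 2) `^ 2^-1); last first.
  apply/funext => x /=; rewrite modulusE powR12_sqrt//.
  by rewrite addr_ge0// sqr_ge0.
apply: (measurableT_comp (measurable_powR _)).
by apply: measurable_funD; exact: measurable_funX.
Qed.

Lemma smeasurable0 : smeasurable (fun=> 0).
Proof. by split; exact: measurable_cst. Qed.

Lemma smeasurableD f g : smeasurable f -> smeasurable g -> smeasurable (f + g).
Proof.
rewrite /smeasurable /sRe /sIm; case: F f g => f g [fr fi] [gr gi]; split.
- exact: measurable_funD.
- exact: measurable_cst.
- rewrite (_ : _ \o _ = (@complex.Re R \o f) \+ (@complex.Re R \o g)); last first.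
    by apply/funext => x /=; rewrite raddfD.
  exact: measurable_funD.
- rewrite (_ : _ \o _ = (@complex.Im R \o f) \+ (@complex.Im R \o g)); last first.
    by apply/funext => x /=; rewrite raddfD.
  exact: measurable_funD.
Qed.

Lemma smeasurableZ (a : K) f : smeasurable f -> smeasurable (a *: f).
Proof.
rewrite /smeasurable /sRe /sIm; case: F a f => a f [fr fi]; split.
- by apply: measurable_funM => //; exact: measurable_cst.
- exact: measurable_cst.
- rewrite (_ : _ \o _ = fun x => complex.Re a * complex.Re (f x) - complex.Im a * complex.Im (f x)).
    by apply: measurable_funB; apply: measurable_funM.
  by apply/funext => x /=; case: a => ? ?; rewrite /GRing.scale /=; case: (f x).
- rewrite (_ : _ \o _ = fun x => complex.Re a * complex.Im (f x) + complex.Im a * complex.Re (f x)).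
    by apply: measurable_funD; apply: measurable_funM.
  by apply/funext => x /=; case: a => ? ?; rewrite /GRing.scale /=; case: (f x).
Qed.

Lemma sLnorm_ge0 f : (0 <= sLnorm f)%E.
Proof. exact: Lnorm_ge0. Qed.

Lemma le_sLnorm (f : T -> K) (h : T -> R) :
  0 < p -> smeasurable f -> measurable_fun setT h ->
  (forall x, modulus (f x) <= h x) -> (sLnorm f <= 'N[mu]_p%:E[EFin \o h])%E.
Proof.
move=> p0 mf mh fh.
have mabs (k : T -> R) : measurable_fun setT k ->
    measurable_fun setT (fun x => (`|(k x)%:E| `^ p)%E).
  move=> mk; rewrite (_ : (fun x => _) = EFin \o (fun x => `|k x| `^ p))//.
  apply/measurable_EFinP; apply: (measurableT_comp (measurable_powR _)).
  exact: measurableT_comp.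
have int0 (k : T -> R) : (0 <= \int[mu]_x (`|(k x)%:E| `^ p))%E.
  by apply: integral_ge0 => x _; exact: poweR_ge0.
rewrite /sLnorm unlock; apply: gt0_ler_poweR.
- by rewrite invr_ge0 ltW.
- by rewrite in_itv/= int0 leey.
- by rewrite in_itv/= int0 leey.
apply: ge0_le_integral => //.
- by move=> x _; exact: poweR_ge0.
- exact: (mabs _ (smeasurable_modulus mf)).
- exact: mabs.
move=> x _ /=; rewrite lee_fin; apply: ge0_ler_powR => //; first exact: ltW.
by rewrite ger0_norm ?modulus_ge0// (le_trans (fh x))// ler_norm.
Qed.

Lemma sLnormD f g : 1 <= p -> smeasurable f -> smeasurable g ->
  (sLnorm (f + g)%R <= sLnorm f + sLnorm g)%E.
Proof.
move=> p1 mf mg; have p0 : 0 < p by exact: lt_le_trans p1.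
have mMf := smeasurable_modulus mf; have mMg := smeasurable_modulus mg.
apply: (le_trans _ (eminkowski mu mMf mMg _)); last by rewrite lee_fin.
apply: le_sLnorm => //; first exact: smeasurableD.
  exact: measurable_funD.
by move=> x; exact: modulusD.
Qed.

Lemma sLnormZ (a : K) f : 0 < p -> smeasurable f ->
  sLnorm (a *: f) = ((modulus a)%:E * sLnorm f)%E.
Proof.
move=> p0 mf; rewrite /sLnorm unlock.
under eq_integral => x _.
  rewrite /= [modulus _]modulusM normrM powRM// EFinM.
  over.
rewrite ge0_integralZl ?lee_fin ?powR_ge0//; last first.
  apply/measurable_EFinP; apply: (measurableT_comp (measurable_powR _)).
  by apply: measurableT_comp => //; exact: smeasurable_modulus.
rewrite poweRM ?lee_fin ?powR_ge0 ?integral_ge0//.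
by rewrite poweR_EFin -powRrM mulfV ?gt_eqF// powRr1// ger0_norm ?modulus_ge0.
Qed.

Lemma eq_sLnorm_ae f g : smeasurable f -> smeasurable g ->
  f = g %[ae mu] -> sLnorm f = sLnorm g.
Proof.
move=> mf mg fg; rewrite /sLnorm unlock; congr (_ `^ _)%E.
have mM (h : T -> K) : smeasurable h ->
    measurable_fun setT (fun x => (`|(EFin \o (@modulus R F \o h)) x| `^ p)%E).
  move=> mh; apply/measurable_EFinP.
  apply: (measurableT_comp (measurable_powR _)).
  by apply: measurableT_comp => //; exact: smeasurable_modulus.
apply: ae_eq_integral => //; [exact: mM|exact: mM|].
exact: (ae_eq_comp (fun z => (`|(modulus z)%:E| `^ p)%E) fg).
Qed.

Lemma sLnorm_eq0 f : 0 < p -> smeasurable f -> sLnorm f = 0%E ->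
  f = (fun=> 0) %[ae mu].
Proof.
move=> p0 mf /Lnorm_eq0_eq0; rewrite lte_fin.
have /measurable_EFinP mMf := smeasurable_modulus mf.
move=> /(_ mMf p0); apply: filterS => x /(_ I) /= [fx0] _.
exact: modulus_eq0.
Qed.

Lemma sLnorm0 : 0 < p -> sLnorm (fun=> 0) = 0%E.
Proof.
move=> p0; rewrite /sLnorm (_ : _ \o _ = cst 0%E) ?Lnorm0 ?gt_eqF//.
by apply/funext => x /=; rewrite modulus0.
Qed.

End LpFunctions.

(* The library's [LspaceType] has real scalars only and carries no algebraic
   structure, whence the following construction of L^p(mu) as the quotient of
   the p-integrable functions by equality almost everywhere.  As in the
   library, the proof of [1 <= p] is a parameter of the types. *)
Section LpFun.
Context d (T : measurableType d) (R : realType).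
Variables (F : scalar_field) (mu : {measure set T -> \bar R}).
Variables (p : R) (p1 : 1 <= p).
Local Notation K := (scalars R F).

Let p0 : 0 < p. Proof. exact: lt_le_trans p1. Qed.

Definition Lp_pred of 1 <= p : {pred (T -> K)} :=
  mem [set f : T -> K | Lp_function mu p f].

Lemma Lp_predP (f : T -> K) : f \in Lp_pred p1 <-> Lp_function mu p f.
Proof. by split=> [/set_mem|/mem_set]. Qed.

Lemma Lp_submod_closed : submod_closed (Lp_pred p1).
Proof.
split; first by apply/Lp_predP; split; [exact: smeasurable0|rewrite sLnorm0].
move=> a f g /Lp_predP[mf lf] /Lp_predP[mg lg]; apply/Lp_predP.
have maf := smeasurableZ a mf; split; first exact: smeasurableD.
rewrite (le_lt_trans (sLnormD mu p1 maf mg))// lte_add_pinfty// sLnormZ//.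
by rewrite lte_mul_pinfty ?lee_fin ?modulus_ge0.
Qed.

HB.instance Definition _ :=
  GRing.isSubmodClosed.Build _ _ (Lp_pred p1) Lp_submod_closed.

Record Lp_fun := LpFun { Lp_val :> T -> K; Lp_valP : Lp_val \in Lp_pred p1 }.

HB.instance Definition _ := [isSub for Lp_val].
HB.instance Definition _ := [Choice of Lp_fun by <:].
HB.instance Definition _ := [SubChoice_isSubLmodule of Lp_fun by <:].

Lemma Lp_fun_smeasurable (f : Lp_fun) : smeasurable f.
Proof. by have /Lp_predP[] := Lp_valP f. Qed.

Lemma Lp_fun_fin (f : Lp_fun) : (sLnorm mu p f < +oo)%E.
Proof. by have /Lp_predP[] := Lp_valP f. Qed.

Lemma Lp_fun_fineK (f : Lp_fun) : (fine (sLnorm mu p f))%:E = sLnorm mu p f.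
Proof.
by rewrite fineK// ge0_fin_numE ?sLnorm_ge0// Lp_fun_fin.
Qed.

Definition Lp_ae_eq (f g : Lp_fun) : bool := `[< Lp_val f = g %[ae mu] >].

Let Lp_ae_eq_refl : reflexive Lp_ae_eq.
Proof. by move=> f; apply/asboolP; exact: ae_eq_refl. Qed.

Let Lp_ae_eq_sym : symmetric Lp_ae_eq.
Proof. by move=> f g; apply/idP/idP => /asboolP fg; apply/asboolP/ae_eq_sym. Qed.

Let Lp_ae_eq_trans : transitive Lp_ae_eq.
Proof.
by move=> f g h /asboolP gf /asboolP fh; apply/asboolP/(ae_eq_trans gf fh).
Qed.

Canonical Lp_ae_eq_equiv :=
  EquivRel Lp_ae_eq Lp_ae_eq_refl Lp_ae_eq_sym Lp_ae_eq_trans.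

Local Open Scope quotient_scope.

Definition Lp : Type := {eq_quot Lp_ae_eq}.
HB.instance Definition _ := Choice.on Lp.
HB.instance Definition _ := EqQuotient.on Lp.

Lemma Lp_eqP (f g : Lp_fun) :
  \pi_Lp f = \pi_Lp g <-> Lp_val f = g %[ae mu].
Proof.
split=> fg; last by apply/eqP; rewrite eqmodE; apply/asboolP.
by move/eqP: fg; rewrite eqmodE => /asboolP.
Qed.

Lemma Lp_ind (P : Lp -> Prop) : (forall f, P (\pi_Lp f)) -> forall x, P x.
Proof. by move=> Pf x; rewrite -[x]reprK. Qed.

Definition Lp_zero : Lp := \pi_Lp 0.
Definition Lp_opp (x : Lp) : Lp := \pi_Lp (- repr x).
Definition Lp_add (x y : Lp) : Lp := \pi_Lp (repr x + repr y).
Definition Lp_scale (a : K) (x : Lp) : Lp := \pi_Lp (a *: repr x).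

Lemma Lp_repr (f : Lp_fun) : Lp_val (repr (\pi_Lp f)) = f %[ae mu].
Proof. by apply/Lp_eqP; rewrite reprK. Qed.

Lemma Lp_oppE (f : Lp_fun) : Lp_opp (\pi_Lp f) = \pi_Lp (- f).
Proof.
apply/Lp_eqP; have := Lp_repr f.
by apply: filterS => x fx /fx /= fxE; rewrite /= fctE fxE.
Qed.

Lemma Lp_addE (f g : Lp_fun) : Lp_add (\pi_Lp f) (\pi_Lp g) = \pi_Lp (f + g).
Proof.
apply/Lp_eqP; have := Lp_repr f; have := Lp_repr g.
by apply: filterS2 => x gx fx xT; rewrite /= !fctE (gx xT) (fx xT).
Qed.

Lemma Lp_scaleE (a : K) (f : Lp_fun) :
  Lp_scale a (\pi_Lp f) = \pi_Lp (a *: f).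
Proof.
apply/Lp_eqP; have := Lp_repr f.
by apply: filterS => x fx xT; rewrite /= !fctE (fx xT).
Qed.

Lemma Lp_addA : associative Lp_add.
Proof.
by elim/Lp_ind=> f; elim/Lp_ind=> g; elim/Lp_ind=> h; rewrite !Lp_addE addrA.
Qed.

Lemma Lp_addC : commutative Lp_add.
Proof. by elim/Lp_ind=> f; elim/Lp_ind=> g; rewrite !Lp_addE addrC. Qed.

Lemma Lp_add0 : left_id Lp_zero Lp_add.
Proof. by elim/Lp_ind=> f; rewrite Lp_addE add0r. Qed.

Lemma Lp_addN : left_inverse Lp_zero Lp_opp Lp_add.
Proof. by elim/Lp_ind=> f; rewrite Lp_oppE Lp_addE addNr. Qed.

HB.instance Definition _ :=
  GRing.isZmodule.Build Lp Lp_addA Lp_addC Lp_add0 Lp_addN.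

Lemma Lp_scaleA (a b : K) (x : Lp) :
  Lp_scale a (Lp_scale b x) = Lp_scale (a * b) x.
Proof. by elim/Lp_ind: x => f; rewrite !Lp_scaleE scalerA. Qed.

Lemma Lp_scale1 : left_id 1 Lp_scale.
Proof. by elim/Lp_ind=> f; rewrite Lp_scaleE scale1r. Qed.

Lemma Lp_scaleDr : right_distributive Lp_scale +%R.
Proof.
move=> a; elim/Lp_ind=> f; elim/Lp_ind=> g.
by rewrite -[_ + _]/(Lp_add _ _) Lp_addE !Lp_scaleE scalerDr -Lp_addE.
Qed.

Lemma Lp_scaleDl (x : Lp) : {morph Lp_scale^~ x : a b / a + b}.
Proof.
by elim/Lp_ind: x => f a b; rewrite !Lp_scaleE scalerDl -Lp_addE.
Qed.

HB.instance Definition _ := GRing.Zmodule_isLmodule.Build K Lp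
  Lp_scaleA Lp_scale1 Lp_scaleDr Lp_scaleDl.

Definition Lp_norm (x : Lp) : K := of_real F (fine (sLnorm mu p (repr x))).

Lemma Lp_normE (f : Lp_fun) :
  Lp_norm (\pi_Lp f) = of_real F (fine (sLnorm mu p f)).
Proof.
rewrite /Lp_norm; congr (of_real _ (fine _)).
by apply: eq_sLnorm_ae (Lp_repr f); exact: Lp_fun_smeasurable.
Qed.

Lemma ler_Lp_normD (x y : Lp) : Lp_norm (x + y) <= Lp_norm x + Lp_norm y.
Proof.
elim/Lp_ind: x => f; elim/Lp_ind: y => g; rewrite -[_ + _]/(Lp_add _ _) Lp_addE.
rewrite !Lp_normE -of_realD ler_of_real -lee_fin EFinD !Lp_fun_fineK.
by apply: sLnormD => //; exact: Lp_fun_smeasurable.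
Qed.

Lemma Lp_normZ (a : K) (x : Lp) : Lp_norm (a *: x) = `|a| * Lp_norm x.
Proof.
elim/Lp_ind: x => f; rewrite -[_ *: _]/(Lp_scale _ _) Lp_scaleE.
rewrite !Lp_normE -of_real_modulus -of_realM; congr of_real.
apply: EFin_inj; rewrite EFinM !Lp_fun_fineK.
by apply: sLnormZ => //; exact: Lp_fun_smeasurable.
Qed.

Lemma Lp_norm_eq0 (x : Lp) : Lp_norm x = 0 -> x = 0.
Proof.
elim/Lp_ind: x => f; rewrite Lp_normE -(of_real0 R F) => /of_real_inj /eqP.
rewrite -eqe Lp_fun_fineK => /eqP f0; apply/Lp_eqP.
by apply: sLnorm_eq0 f0 => //; exact: Lp_fun_smeasurable.
Qed.

HB.instance Definition _ :=
  Lmodule_isNormed.Build K Lp ler_Lp_normD Lp_normZ Lp_norm_eq0.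

Lemma Lp_pi_normE (f : Lp_fun) :
  `|\pi_Lp f| = of_real F (fine (sLnorm mu p f)).
Proof. exact: Lp_normE. Qed.

End LpFun.

Section Presentations.
Variables (R : realType) (F : scalar_field).
Local Notation K := (scalars R F).
Variable V : normedModType K.
Implicit Types v : nat -> V.

Definition presentation v : Prop :=
  dense [set x : V | exists (n : nat) (a : 'I_n -> K),
                       x = \sum_(j < n) a j *: v j].

(* Every rational vector is a [rational_vector v m]: the entries of the sequence
   encoded by [m] name its coefficients, so [m] plays the part of the tuple of
   rational scalars. *)
Definition rational_vector v (m : nat) : V :=
  let s := CodeSeq.decode m in
  \sum_(j < size s) scalar_of_code R F (nth 0%N s j) *: v j.

Definition computable_presentation v : Prop :=
  presentation v /\
  exists2 q : nat -> nat -> nat, computable2 q &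
    forall k m : nat,
      `|ratr (rat_of_code (q k m)) - `|rational_vector v m| | < 2 ^- k :> K.

Definition dim_ge2 : Prop :=
  exists x y : V, forall a b : K, a *: x + b *: y = 0 -> a = 0 /\ b = 0.

End Presentations.

Lemma ge2_ge1 (R : realType) (p : R) : 2 <= p -> 1 <= p.
Proof. by apply: le_trans; rewrite ler1n. Qed.

(* Main.v *)
Require Import Defs.
From mathcomp Require Import all_boot all_order all_algebra.
From mathcomp Require Import all_classical all_reals all_analysis.
From mathcomp Require Import complex measurable_realfun zify ring lra.

(* Let [p > 2], the case [p = 2] being trivial.  For unit vectors [u], [v] of
   L^p, Clarkson's inequality [|u + v|^p + |u - v|^p >= 4] bounds
   [max |u + v| |u - v|] from below by [2^(1/p)], so every pair yields a lower
   bound on [p].  Conversely, a small second difference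
   [|u + v/N|^p + |u - v/N|^p - 2 |u|^p], relatively to [1/N^2], forces the
   integral of [|u|^(p-2) |v|^2] to be small, hence [u] and [v] to be almost
   disjointly supported and [|u + v|^p] to be hardly larger than [2]; this
   yields an upper bound on [p].  All these conditions are strict inequalities
   between norms of rational vectors, thus semi-decidable, and they hold for
   approximations of a pair of disjointly supported unit vectors, because
   [N^2 N^(-p)] tends to [0].  Such a pair exists in dimension at least [2]:
   otherwise all functions would be supported on one atom. *)

Set Implicit Arguments.
Unset Strict Implicit.
Unset Printing Implicit Defensive.
Import Order.TTheory GRing.Theory Num.Theory.
Import numFieldNormedType.Exports.

Local Open Scope nat_scope.

(** * Recursive functions *)

(** The obstacle is that a test run by the algorithm cannot mention [p]. Real powers are therefore
    compared through integer ones: for a bound [x] on a norm, [x ^ a < 2 ^ b] is a statement about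
    naturals, and it says something about [p] as soon as the [p]-th power of that norm is known to
    be at least [2]. Likewise a fixed integer [P >= p] replaces [p] wherever only an upper bound is
    wanted. For [b = 2 ^ k] the search looks for an integer [a] with [a < p b < a + 2]. The length
    is [2] and not [1] because [p b] may itself be an integer while both inequalities are strict;
    [(a + 1) / b] is then the required approximation. Every accepted pair of vectors gives correct
    bounds; the disjointly supported pair serves only to show that the search ends. The test is
    phrased in natural numbers throughout, with rounding errors put into its constants, so that its
    recursiveness reduces to that of elementary arithmetic and of sequence codes. *)

Lemma eq_recursive n (f g : n.-tuple nat -> nat) :
  f =1 g -> recursive f -> recursive g.
Proof. by move=> /funext ->. Qed.

Lemma recursive_comp1 n (h : nat -> nat) (f : n.-tuple nat -> nat) :
  computable1 h -> recursive f -> recursive (fun x => h (f x)).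
Proof.
move=> rh rf; have := recursive_comp rh (fun=> rf).
by apply: eq_recursive => x; rewrite tnth_mktuple.
Qed.

Lemma recursive_comp2 n (h : nat -> nat -> nat) (f g : n.-tuple nat -> nat) :
  computable2 h -> recursive f -> recursive g ->
  recursive (fun x => h (f x) (g x)).
Proof.
move=> rh rf rg.
have rfg (i : 'I_2) : recursive (if i == ord0 then f else g) by case: ifP.
have := recursive_comp rh rfg.
by apply: eq_recursive => x; rewrite !tnth_mktuple.
Qed.

Lemma recursive_S n (f : n.-tuple nat -> nat) :
  recursive f -> recursive (fun x => (f x).+1).
Proof. exact: recursive_comp1 recursive_succ. Qed.

Lemma recursive_const n c : recursive (fun _ : n.-tuple nat => c).
Proof.
by elim: c => [|c IH]; [exact: recursive_zero|exact: recursive_S IH].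
Qed.

Lemma inordS_lift n (i : 'I_n) : inord i.+1 = lift ord0 i.
Proof. by apply: val_inj; rewrite /= inordK// ltnS. Qed.

Lemma recursive_behead n (f : n.-tuple nat -> nat) : recursive f ->
  recursive (fun y : n.+1.-tuple nat => f [tuple of behead y]).
Proof.
move=> rf; have := recursive_comp rf (fun i => recursive_proj (lift ord0 i)).
apply: eq_recursive => y; congr f; apply: eq_from_tnth => i.
by rewrite tnth_mktuple tnth_behead inordS_lift.
Qed.

Lemma recursive_cons n (h : n.+1.-tuple nat -> nat) (f : n.-tuple nat -> nat) :
  recursive h -> recursive f -> recursive (fun x => h [tuple of f x :: x]).
Proof.
move=> rh rf; pose g (i : 'I_n.+1) : n.-tuple nat -> nat :=
  if unlift ord0 i is Some j then fun x => tnth x j else f.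
have rg i : recursive (g i).
  by rewrite /g; case: unlift => [j|]//; exact: recursive_proj.
have := recursive_comp rh rg.
apply: eq_recursive => x; congr h; apply: eq_from_tnth => i.
rewrite tnth_mktuple /g; case: unliftP => [j ->|->]; last by rewrite tnth0.
by rewrite tnthS.
Qed.

Lemma behead_cons_tuple n (a : nat) (x : n.-tuple nat) :
  [tuple of behead [tuple of a :: x]] = x.
Proof. exact: val_inj. Qed.

Lemma recursive_iteri n (m f : n.-tuple nat -> nat)
    (g : nat -> nat -> n.-tuple nat -> nat) :
  recursive m -> recursive f ->
  recursive (fun y : n.+2.-tuple nat =>
    g (thead y) (thead [tuple of behead y])
      [tuple of behead [tuple of behead y]]) ->
  recursive (fun x => iteri (m x) (fun k r => g k r x) (f x)).
Proof.
move=> rm rf rg; have := recursive_cons (recursive_primrec rf rg) rm.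
apply: eq_recursive => x; rewrite theadE behead_cons_tuple.
congr (iteri _ _ _); apply/funext => k; apply/funext => r.
by rewrite !behead_cons_tuple !theadE.
Qed.

Lemma recursive_thead n : recursive (fun y : n.+1.-tuple nat => thead y).
Proof. exact: recursive_proj. Qed.

(** Characterizing [g x] as the least zero of [f] in its first argument provides at once the
    totality that [recursive_mu] demands and the value of the minimization. Division, valuations and
    the final search are all obtained this way. *)
Lemma recursive_argmin n (f : nat -> n.-tuple nat -> nat) (g : n.-tuple nat -> nat) :
  (forall x, f (g x) x = 0) -> (forall x y, f y x = 0 -> g x <= y) ->
  recursive (fun y : n.+1.-tuple nat => f (thead y) [tuple of behead y]) ->
  recursive g.
Proof.
move=> fg gmin rf.
pose f' (y : n.+1.-tuple nat) := f (thead y) [tuple of behead y].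
have f'E y (x : n.-tuple nat) : f' [tuple of y :: x] = f y x.
  by rewrite /f' theadE behead_cons_tuple.
have f0 (x : n.-tuple nat) : exists y, f' [tuple of y :: x] == 0.
  by exists (g x); rewrite f'E fg.
have := recursive_mu f0 rf; apply: eq_recursive => x.
case: ex_minnP => y /eqP; rewrite f'E => /gmin gy ymin.
by apply/eqP; rewrite eqn_leq gy andbT ymin// f'E fg.
Qed.

Ltac recursive_leaf :=
  first [assumption | exact: recursive_const | exact: recursive_thead
        | exact: recursive_proj].

Section Arithmetic.
Variable n : nat.
Implicit Types f g h : n.-tuple nat -> nat.

Lemma recursive_add f g :
  recursive f -> recursive g -> recursive (fun x => f x + g x).
Proof.
move=> rf rg.
have : recursive (fun x => iteri (g x) (fun _ r => r.+1) (f x)).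
  apply: (recursive_iteri (g := fun _ r _ => r.+1)) => //.
  exact: recursive_S (recursive_behead (recursive_thead _)).
apply: eq_recursive => x; elim: (g x) => [|k /= ->]; first by rewrite addn0.
by rewrite addnS.
Qed.

Lemma recursive_pred f : recursive f -> recursive (fun x => (f x).-1).
Proof.
move=> rf.
have : recursive (fun x => iteri (f x) (fun k _ => k) 0).
  apply: (recursive_iteri (g := fun k _ _ => k)) => //.
    exact: recursive_const.
  exact: recursive_thead.
by apply: eq_recursive => x; case: (f x).
Qed.

End Arithmetic.

Section Arithmetic2.
Variable n : nat.
Implicit Types f g h : n.-tuple nat -> nat.

Lemma recursive_sub f g :
  recursive f -> recursive g -> recursive (fun x => f x - g x).
Proof.
move=> rf rg.
have : recursive (fun x => iteri (g x) (fun _ r => r.-1) (f x)).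
  apply: (recursive_iteri (g := fun _ r _ => r.-1)) => //.
  exact: recursive_pred (recursive_behead (recursive_thead _)).
apply: eq_recursive => x; elim: (g x) => [|k /= ->]; first by rewrite subn0.
by rewrite subnS.
Qed.

Lemma recursive_mul f g :
  recursive f -> recursive g -> recursive (fun x => f x * g x).
Proof.
move=> rf rg.
have : recursive (fun x => iteri (g x) (fun _ r => r + f x) 0).
  apply: (recursive_iteri (g := fun _ r x => r + f x)) => //.
    exact: recursive_const.
  apply: recursive_add; first exact: (recursive_behead (recursive_thead _)).
  exact: (recursive_behead (recursive_behead rf)).
apply: eq_recursive => x; elim: (g x) => [|k /= ->]; first by rewrite muln0.
by rewrite mulnS addnC.
Qed.
End Arithmetic2.

Section Arithmetic3.
Variable n : nat.
Implicit Types f g h : n.-tuple nat -> nat.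

Lemma recursive_exp f g :
  recursive f -> recursive g -> recursive (fun x => f x ^ g x).
Proof.
move=> rf rg.
have : recursive (fun x => iteri (g x) (fun _ r => r * f x) 1).
  apply: (recursive_iteri (g := fun _ r x => r * f x)) => //.
    exact: recursive_const.
  apply: recursive_mul; first exact: (recursive_behead (recursive_thead _)).
  exact: (recursive_behead (recursive_behead rf)).
apply: eq_recursive => x; elim: (g x) => [|k /= ->] //.
by rewrite expnSr.
Qed.

Lemma recursive_divn f g :
  recursive f -> recursive g -> recursive (fun x => f x %/ g x).
Proof.
move=> rf rg.
(* The last factor makes every [y] a zero when the divisor is [0]; the least one is then [0], the
   conventional value of division by [0]. *)
apply: (recursive_argmin (f := fun y x => ((f x).+1 - y.+1 * g x) * g x)).
- move=> x; have [->|g0] := posnP (g x); first by rewrite muln0.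
  by apply/eqP; rewrite muln_eq0 subn_eq0 ltn_ceil.
- move=> x y /eqP; rewrite muln_eq0 subn_eq0 orbC.
  have [->|g0] := posnP (g x); first by rewrite divn0.
  by rewrite /= => h; rewrite -ltnS ltn_divLR.
apply: recursive_mul; last exact: recursive_behead.
apply: recursive_sub; first exact: recursive_S (recursive_behead rf).
apply: recursive_mul; last exact: recursive_behead.
exact: recursive_S (recursive_thead _).
Qed.
End Arithmetic3.

(** [CodeSeq.code (a :: s)] is [2 ^ a * (2 * CodeSeq.code s + 1)] and [0] codes the empty sequence:
    the head is the 2-adic valuation, the tail the half of the odd part, rounded down. *)
Definition code_head (w : nat) := logn 2 w.
Definition code_behead (w : nat) := w %/ 2 ^ (code_head w).+1.

Lemma code_head_cons a s : code_head (CodeSeq.code (a :: s)) = a.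
Proof.
rewrite /code_head /= lognM ?expn_gt0// pfactorK// logn_coprime ?addn0//.
by rewrite prime_coprime// dvdn2 /= odd_double.
Qed.

Lemma code_behead_cons a s :
  code_behead (CodeSeq.code (a :: s)) = CodeSeq.code s.
Proof.
rewrite /code_behead code_head_cons /= expnSr divnMl ?expn_gt0//.
by rewrite divn2 -[_.*2.+1]/(true + _.*2) half_bit_double.
Qed.

Definition code_nth (w i : nat) := nth 0 (CodeSeq.decode w) i.

(** Reading past the end is consistent: [0] has head and tail [0], which agrees with the default
    value of [nth]. *)
Lemma code_nthE w i :
  code_nth w i = code_head (iteri i (fun _ r => code_behead r) w).
Proof.
rewrite /code_nth -{2}[w]CodeSeq.decodeK; elim: i (CodeSeq.decode w) => [|i IH] s.
  by case: s => [|a s]; rewrite ?code_head_cons.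
suff -> : iteri i.+1 (fun _ r => code_behead r) (CodeSeq.code s) =
  iteri i (fun _ r => code_behead r) (CodeSeq.code (behead s)).
  by rewrite -IH; case: s => //=; rewrite nth_nil.
transitivity (iteri i (fun _ r => code_behead r) (code_behead (CodeSeq.code s))).
  by elim: i {IH} => //= i ->.
congr iteri; case: s => [|a s]; first by [].
exact: code_behead_cons.
Qed.

Lemma recursive_code_head n (f : n.-tuple nat -> nat) :
  recursive f -> recursive (fun x => code_head (f x)).
Proof.
move=> rf.
(* Zero exactly when [f x] is [0] or is not divisible by [2 ^ y.+1]; the least such [y] is the
   valuation, including the value [0] at [0]. *)
apply: (recursive_argmin (f := fun y x =>
  f x * (1 - (f x - f x %/ 2 ^ y.+1 * 2 ^ y.+1)))).
- move=> x; have [->|f0] := posnP (f x); first by rewrite mul0n.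
  apply/eqP; rewrite muln_eq0 subn_eq0; apply/orP; right.
  rewrite subn_gt0 ltn_neqAle leq_trunc_div andbT; apply/negP => /eqP e.
  have : 2 ^ (code_head (f x)).+1 %| f x by rewrite dvdn_eq e.
  by rewrite pfactor_dvdn// ltnn.
- move=> x y /eqP; rewrite muln_eq0 subn_eq0 subn_gt0.
  move=> /orP[/eqP ->//|h]; rewrite leqNgt -pfactor_dvdn//; last first.
    by apply: leq_ltn_trans h.
  by rewrite dvdn_eq; rewrite ltn_neqAle in h; case/andP: h.
have r2 : recursive (fun y : n.+1.-tuple nat => 2 ^ (thead y).+1).
  apply: recursive_exp; first exact: recursive_const.
  exact: recursive_S (recursive_thead _).
have rf' := recursive_behead rf.
apply: recursive_mul => //.
apply: recursive_sub; first exact: recursive_const.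
apply: recursive_sub => //; apply: recursive_mul => //.
exact: recursive_divn.
Qed.

Lemma recursive_code_nth n (f g : n.-tuple nat -> nat) :
  recursive f -> recursive g -> recursive (fun x => code_nth (f x) (g x)).
Proof.
move=> rf rg.
under eq_fun do rewrite code_nthE.
apply: recursive_code_head.
apply: (recursive_iteri (g := fun _ r _ => code_behead r)) => //.
have rt := recursive_behead (recursive_thead n).
apply: recursive_divn => //; apply: recursive_exp; first exact: recursive_const.
by apply: recursive_S; exact: recursive_code_head.
Qed.

Lemma recursive_code_cons n (f : n.-tuple nat -> nat)
    (s : n.-tuple nat -> seq nat) :
  recursive f -> recursive (fun x => CodeSeq.code (s x)) ->
  recursive (fun x => CodeSeq.code (f x :: s x)).
Proof.
move=> rf rs; rewrite /=.
apply: recursive_mul; first by apply: recursive_exp => //; exact: recursive_const.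
by apply: recursive_S; under eq_fun do rewrite -addnn; exact: recursive_add.
Qed.

(** A code is a right fold, so the sequence is built from its end: round [k] of the iteration
    prepends the entry of index [m x - k.+1]. *)
Lemma recursive_code_mkseq n (h : nat -> n.-tuple nat -> nat) (m : n.-tuple nat -> nat) :
  recursive m ->
  recursive (fun y : n.+1.-tuple nat => h (thead y) [tuple of behead y]) ->
  recursive (fun x => CodeSeq.code (mkseq (h^~ x) (m x))).
Proof.
move=> rm rh.
have : recursive (fun x => iteri (m x)
    (fun k r => 2 ^ h (m x - k.+1) x * (r + r).+1) 0).
  apply: (recursive_iteri (g := fun k r x => 2 ^ h (m x - k.+1) x * (r + r).+1)) => //.
    exact: recursive_const.
  apply: recursive_mul; last first.
    have rt := recursive_behead (recursive_thead n).
    by apply: recursive_S; exact: recursive_add.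
  apply: recursive_exp; first exact: recursive_const.
  pose f (y : n.+2.-tuple nat) := m [tuple of behead [tuple of behead y]] - (thead y).+1.
  have rf : recursive f.
    apply: recursive_sub; first exact: (recursive_behead (recursive_behead rm)).
    exact: recursive_S (recursive_thead _).
  (* Weakening by the two variables of the iteration, the counter and the accumulator, which stand
     between the index and the parameters. *)
  have rh' : recursive (fun z : n.+3.-tuple nat =>
      h (thead z) [tuple of behead [tuple of behead [tuple of behead z]]]).
    have := recursive_comp rh (g := fun i => if unlift ord0 i is Some j then
      fun z : n.+3.-tuple nat => tnth [tuple of behead [tuple of behead [tuple of behead z]]] j
      else fun z => thead z).
    have rg i : recursive (if unlift ord0 i is Some j then
      fun z : n.+3.-tuple nat => tnth [tuple of behead [tuple of behead [tuple of behead z]]] j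
      else fun z => thead z).
      case: unlift => [j|]; last exact: recursive_thead.
      exact: (recursive_behead (recursive_behead (recursive_behead (recursive_proj j)))).
    move=> /(_ rg); apply: eq_recursive => z; congr h.
      by rewrite /thead tnth_mktuple unlift_none.
    by apply: eq_from_tnth => i; rewrite tnth_behead tnth_mktuple inordS_lift liftK.
  have := recursive_cons rh' rf.
  by apply: eq_recursive => y; rewrite theadE behead_cons_tuple.
apply: eq_recursive => x; rewrite /mkseq.
suff E k : k <= m x ->
    iteri k (fun k r => 2 ^ h (m x - k.+1) x * (r + r).+1) 0 =
    CodeSeq.code [seq h i x | i <- iota (m x - k) k].
  by rewrite E// subnn.
elim: k => [|k IH] km //=; rewrite IH 1?ltnW// addnn.
by rewrite -subSn// subSS.
Qed.

Local Open Scope ring_scope.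

(** * Pointwise inequalities *)

Section PowerInequalities.
Variable R : realType.
Implicit Types x y r p : R.

Lemma powR_half_sqr x p : 0 <= x -> (x ^+ 2) `^ (p / 2) = x `^ p.
Proof. by move=> x0; rewrite -powR_mulrn// -powRrM mulrC divfK. Qed.

Lemma powR_mean x y r : 1 <= r -> 0 <= x -> 0 <= y ->
  2 * ((x + y) / 2) `^ r <= x `^ r + y `^ r.
Proof.
move=> r1 x0 y0.
have h0 : 0 <= 2^-1 :> R by lra.
have h1 : 2^-1 <= 1 :> R by lra.
have h : (2^-1 * x + (1 - 2^-1) * y) `^ r <=
    2^-1 * x `^ r + (1 - 2^-1) * y `^ r.
  by apply: (@convex_powR R r r1 (Itv01 h0 h1) x y);
    rewrite inE/= in_itv/= ?x0 ?y0.
have -> : (x + y) / 2 = 2^-1 * x + (1 - 2^-1) * y by lra.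
lra.
Qed.

Lemma powR_pred x r : 0 <= x -> 1 <= r -> x `^ r = x `^ (r - 1) * x.
Proof. by move=> x0 r1; rewrite mulrC mulr_powRB1// (lt_le_trans _ r1). Qed.

(** One factor [x + y] is split off, and the remaining power of exponent [r - 1 >= 0] is monotone.
    Keeping [y] linear is what produces the term [|a|^(p-2) |b|^2] when [r = p / 2] is applied to
    squared moduli. *)
Lemma powR_superadd_mul x y r : 1 <= r -> 0 <= x -> 0 <= y ->
  x `^ r + x `^ (r - 1) * y <= (x + y) `^ r.
Proof.
move=> r1 x0 y0.
rewrite (powR_pred x0 r1) (powR_pred (addr_ge0 x0 y0) r1) -mulrDr.
rewrite ler_wpM2r ?addr_ge0// ge0_ler_powR ?nnegrE ?subr_ge0 ?addr_ge0//.
by rewrite lerDl.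
Qed.

Lemma powR_superadd x y r : 1 <= r -> 0 <= x -> 0 <= y ->
  x `^ r + y `^ r <= (x + y) `^ r.
Proof.
move=> r1 x0 y0.
rewrite (powR_pred x0 r1) (powR_pred y0 r1) (powR_pred (addr_ge0 x0 y0) r1) mulrDr.
by apply: lerD; rewrite ler_wpM2r// ge0_ler_powR ?nnegrE ?subr_ge0 ?addr_ge0//
  (lerDl, lerDr).
Qed.

End PowerInequalities.

Section ModulusInequalities.
Variables (R : realType) (F : scalar_field) (p : R).
Hypothesis p2 : 2 <= p.
Local Notation K := (scalars R F).
Local Notation modulus := (@modulus R F).
Implicit Types a b : K.

Lemma modulusN a : modulus (- a) = modulus a.
Proof. by rewrite /Defs.modulus normrN. Qed.

Lemma modulus_parallelogram a b :
  modulus (a + b) ^+ 2 + modulus (a - b) ^+ 2 =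
  2 * (modulus a ^+ 2 + modulus b ^+ 2).
Proof.
rewrite !modulusE !sqr_sqrtr ?addr_ge0 ?sqr_ge0// /sRe /sIm.
by case: F a b => [|] a b; [rewrite /=; ring|case: a b => [? ?] [? ?] /=; ring].
Qed.

(** Convexity of the power [p / 2 >= 1] at the squared moduli, followed by the parallelogram law.
    Clarkson's inequality and [modulus_smoothness] differ only in the lower bound then used for the
    power of a sum. *)
Lemma modulus_powR_mean a b :
  2 * (modulus a ^+ 2 + modulus b ^+ 2) `^ (p / 2) <=
  modulus (a + b) `^ p + modulus (a - b) `^ p.
Proof.
have h : 1 <= p / 2 by move: p2 => ?; lra.
have := powR_mean h (sqr_ge0 (modulus (a + b))) (sqr_ge0 (modulus (a - b))).
by rewrite !powR_half_sqr ?modulus_ge0// modulus_parallelogram mulrAC mulfV// mul1r.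
Qed.

Lemma modulus_clarkson a b :
  2 * (modulus a `^ p + modulus b `^ p) <=
  modulus (a + b) `^ p + modulus (a - b) `^ p.
Proof.
apply: le_trans (modulus_powR_mean a b); rewrite ler_pM2l//.
have h : 1 <= p / 2 by move: p2 => ?; lra.
have := powR_superadd h (sqr_ge0 (modulus a)) (sqr_ge0 (modulus b)).
by rewrite !powR_half_sqr ?modulus_ge0.
Qed.

Lemma modulus_smoothness a b :
  2 * (modulus a `^ p + modulus a `^ (p - 2) * modulus b ^+ 2) <=
  modulus (a + b) `^ p + modulus (a - b) `^ p.
Proof.
apply: le_trans (modulus_powR_mean a b); rewrite ler_pM2l//.
have h : 1 <= p / 2 by move: p2 => ?; lra.
have := powR_superadd_mul h (sqr_ge0 (modulus a)) (sqr_ge0 (modulus b)).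
have -> : p / 2 - 1 = (p - 2) / 2 by lra.
by rewrite !powR_half_sqr ?modulus_ge0.
Qed.

(** If one of the moduli is at least [n] times the other, the first term suffices. Otherwise
    [|a + b| <= (n + 1) |a|] and [|a| <= (n + 1) |b|], so [|a + b|^p <= (n + 1)^(p + 2) |a|^(p-2)
    |b|^2]; rounding [p] up to [P] makes the constant an integer available to the algorithm. *)
Lemma modulus_add_upper (n P : nat) a b : (0 < n)%N -> p <= P%:R ->
  modulus (a + b) `^ p <=
  (1 + n%:R^-1) `^ p * (modulus a `^ p + modulus b `^ p) +
  (n.+1 ^ (P + 2))%:R * (modulus a `^ (p - 2) * modulus b ^+ 2).
Proof.
move=> n0 pP; have p0 : 0 <= p by move: p2 => ?; lra.
have nR : 0 < n%:R :> R by rewrite ltr0n.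
have Ap := powR_ge0 (modulus a) p; have Bp := powR_ge0 (modulus b) p.
have Cp := powR_ge0 (modulus a) (p - 2).
have A0 := modulus_ge0 a; have B0 := modulus_ge0 b.
have D := modulusD a b.
have np : 0 <= 1 + n%:R^-1 :> R by rewrite addr_ge0// invr_ge0 ltW.
have rest0 : 0 <= (n.+1 ^ (P + 2))%:R * (modulus a `^ (p - 2) * modulus b ^+ 2).
  by rewrite mulr_ge0// mulr_ge0// sqr_ge0.
have mono (x : R) : 0 <= x -> modulus (a + b) <= x -> modulus (a + b) `^ p <= x `^ p.
  by move=> x0 ax; rewrite ge0_ler_powR ?nnegrE ?modulus_ge0.
have [ba|ab] := leP (n%:R * modulus b) (modulus a).
  apply: (@le_trans _ _ ((1 + n%:R^-1) `^ p * modulus a `^ p)).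
    rewrite -powRM//; apply: mono; first exact: mulr_ge0.
    rewrite (le_trans D)// mulrDl mul1r lerD2l mulrC ler_pdivlMr// mulrC.
    exact: ba.
  by rewrite mulrDr -addrA lerDl addr_ge0// mulr_ge0 ?powR_ge0.
have [ba'|ab'] := leP (n%:R * modulus a) (modulus b).
  apply: (@le_trans _ _ ((1 + n%:R^-1) `^ p * modulus b `^ p)).
    rewrite -powRM//; apply: mono; first exact: mulr_ge0.
    rewrite (le_trans D)// mulrDl mul1r addrC lerD2l mulrC ler_pdivlMr// mulrC.
    exact: ba'.
  by rewrite mulrDr -addrA addrCA lerDl addr_ge0// mulr_ge0 ?powR_ge0.
have rest1 : 0 <= (1 + n%:R^-1) `^ p * (modulus a `^ p + modulus b `^ p).
  by rewrite mulr_ge0 ?powR_ge0// addr_ge0.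
apply: le_trans (_ : _ <= (n.+1%:R * modulus a) `^ p) _.
  apply: mono; first exact: mulr_ge0.
  by rewrite (le_trans D)// -addn1 natrD mulrDl mul1r addrC lerD2r ltW.
rewrite powRM//; apply: le_trans (_ : _ <=
  (n.+1 ^ (P + 2))%:R * (modulus a `^ (p - 2) * modulus b ^+ 2)) _;
  last by rewrite lerDr.
have -> : modulus a `^ p = modulus a `^ (p - 2) * modulus a ^+ 2.
  by rewrite -powR_mulrn// -powRD ?subrK//; apply/implyP => _; rewrite gt_eqF//; nra.
set X := modulus a `^ (p - 2) in Cp *.
have aa : modulus a ^+ 2 <= n.+1%:R ^+ 2 * modulus b ^+ 2.
  rewrite -exprMn lerXn2r ?nnegrE ?mulr_ge0//; apply: ltW (lt_le_trans ab _).
  by rewrite ler_wpM2r// ler_nat.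
have nn : n.+1%:R `^ p <= n.+1%:R ^+ P :> R.
  by rewrite -powR_mulrn// ler_powR// ler1n.
rewrite natrX exprD -mulrA.
apply: (ler_pM (powR_ge0 _ _) (mulr_ge0 Cp (sqr_ge0 _)) nn).
by rewrite [leRHS]mulrCA; apply: ler_wpM2l.
Qed.

(* By [modulus_smoothness], the second difference on the right exceeds
   [c * modulus a `^ p] by enough to absorb the error term of
   [modulus_add_upper]. *)
Lemma modulus_second_difference (n P : nat) (c : R) a b t :
  (0 < n)%N -> p <= P%:R ->
  c = (n.+1 ^ (P + 2))%:R ->
  modulus t ^+ 2 * modulus (a + b) `^ p + c * modulus a `^ p <=
  modulus t ^+ 2 * ((1 + n%:R^-1) `^ p * (modulus a `^ p + modulus b `^ p)) +
  c / 2 * (modulus (a + t * b) `^ p + modulus (a - t * b) `^ p).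
Proof.
move=> n0 pP cE.
have := modulus_smoothness a (t * b); rewrite modulusM exprMn => h1.
have := modulus_add_upper a b n0 pP; rewrite -cE => h2.
have c0 : 0 <= c by rewrite cE.
have t0 : 0 <= modulus t ^+ 2 by exact: sqr_ge0.
have := ler_wpM2l t0 h2; have := ler_wpM2l c0 h1.
set A := modulus a `^ p; set X := modulus a `^ (p - 2).
set S := modulus (a + b) `^ p; set E := _ `^ p * (A + _).
set U := modulus (a + t * b) `^ p; set V := modulus (a - t * b) `^ p.
nra.
Qed.

End ModulusInequalities.

Local Open Scope classical_set_scope.

(** * Norm inequalities in L^p *)

Section RealNorm.
Variables (R : realType) (F : scalar_field) (V : normedModType (scalars R F)).
Implicit Types x y : V.

Definition rnorm x : R := sRe `|x|.

Lemma of_real_rnorm x : of_real F (rnorm x) = `|x|.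
Proof.
have : 0 <= `|x| by [].
rewrite /rnorm; move: `|x|; case: F => //= z z0.
by rewrite RRe_real// ger0_real.
Qed.

Lemma rnorm_ge0 x : 0 <= rnorm x.
Proof. by rewrite -(ler_of_real F) of_real0 of_real_rnorm. Qed.

Lemma rnormD x y : rnorm (x + y) <= rnorm x + rnorm y.
Proof. by rewrite -(ler_of_real F) of_realD !of_real_rnorm ler_normD. Qed.

Lemma rnormN x : rnorm (- x) = rnorm x.
Proof. by rewrite /rnorm normrN. Qed.

Lemma rnormZ a x : rnorm (a *: x) = modulus a * rnorm x.
Proof.
by apply: (@of_real_inj R F); rewrite of_realM of_real_modulus !of_real_rnorm normrZ.
Qed.

Lemma rnormB x y : rnorm x - rnorm y <= rnorm (x - y).
Proof. by rewrite lerBlDr (le_trans _ (rnormD _ _))// subrK. Qed.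

End RealNorm.

Section LpNorm.
Context d (T : measurableType d) (R : realType).
Variables (F : scalar_field) (mu : {measure set T -> \bar R}).
Variables (p : R) (p2 : 2 <= p).
Local Notation K := (scalars R F).
Local Notation p1 := (ge2_ge1 p2).
Local Notation Lp := (Lp F mu p1).
Local Notation Lp_fun := (Lp_fun F mu p1).
Implicit Types f g : Lp_fun.

Let p0 : 0 < p. Proof. exact: lt_le_trans p2. Qed.

Definition powR_modulus (f : T -> K) : T -> R := fun x => modulus (f x) `^ p.
Local Notation W := powR_modulus.

Lemma integral_powR_modulus (f : T -> K) :
  (\int[mu]_x (W f x)%:E = sLnorm mu p f `^ p)%E.
Proof.
rewrite /sLnorm poweR_Lnorm ?gt_eqF//; apply: eq_integral => x _.
by rewrite /= ger0_norm ?modulus_ge0.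
Qed.

Lemma measurable_powR_modulus (f : T -> K) :
  smeasurable f -> measurable_fun setT (W f).
Proof.
by move=> mf; apply: (measurableT_comp (measurable_powR _));
  exact: smeasurable_modulus.
Qed.

Lemma integrable_powR_modulus f : mu.-integrable setT (EFin \o W f).
Proof.
apply/integrableP; split.
  exact/measurable_EFinP/measurable_powR_modulus/Lp_fun_smeasurable.
under eq_integral => x _ do rewrite /= ger0_norm ?powR_ge0//.
by rewrite integral_powR_modulus poweR_lty// Lp_fun_fin.
Qed.

Lemma rnorm_pi f : rnorm (\pi_Lp f)%qT `^ p = \int[mu]_x W f x.
Proof.
rewrite /Rintegral integral_powR_modulus fine_poweR; congr (_ `^ _).
apply: (@of_real_inj R F); rewrite of_real_rnorm; exact: Lp_pi_normE.
Qed.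

Lemma Lp_clarkson (x y : Lp) :
  2 * (rnorm x `^ p + rnorm y `^ p) <= rnorm (x + y) `^ p + rnorm (x - y) `^ p.
Proof.
elim/Lp_ind: x => f; elim/Lp_ind: y => g.
have -> : (\pi_Lp f + \pi_Lp g = \pi_Lp (f + g))%qT by exact: Lp_addE.
have -> : (\pi_Lp f - \pi_Lp g = \pi_Lp (f - g))%qT.
  by rewrite -[LHS]/(Lp_add _ (Lp_opp _)) Lp_oppE Lp_addE.
rewrite !rnorm_pi.
have I := integrable_powR_modulus.
rewrite -!RintegralD// -RintegralZl//; last exact: (integrableD _ (I f) (I g)).
apply: le_Rintegral => //.
- exact: (integrableZl _ 2 (integrableD _ (I f) (I g))).
- exact: (integrableD _ (I (f + g)) (I (f - g))).
- by move=> x _; exact: modulus_clarkson.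
Qed.

Lemma Lp_second_difference (n P : nat) (c : R) (t : K) (x y : Lp) :
  (0 < n)%N -> p <= P%:R ->
  c = (n.+1 ^ (P + 2))%:R ->
  modulus t ^+ 2 * rnorm (x + y) `^ p + c * rnorm x `^ p <=
  modulus t ^+ 2 * ((1 + n%:R^-1) `^ p * (rnorm x `^ p + rnorm y `^ p)) +
  c / 2 * (rnorm (x + t *: y) `^ p + rnorm (x - t *: y) `^ p).
Proof.
move=> n0 pP cE.
elim/Lp_ind: x => f; elim/Lp_ind: y => g.
have -> : (\pi_Lp f + \pi_Lp g = \pi_Lp (f + g))%qT by exact: Lp_addE.
have -> : (t *: \pi_Lp g = \pi_Lp (t *: g))%qT by exact: Lp_scaleE.
have -> : (\pi_Lp f + \pi_Lp (t *: g) = \pi_Lp (f + t *: g))%qT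
  by exact: Lp_addE.
have -> : (\pi_Lp f - \pi_Lp (t *: g) = \pi_Lp (f - t *: g))%qT.
  by rewrite -[LHS]/(Lp_add _ (Lp_opp _)) Lp_oppE Lp_addE.
rewrite !rnorm_pi.
have I := integrable_powR_modulus.
have IZ k f' : mu.-integrable setT (EFin \o (fun x => k * W f' x)).
  exact: (integrableZl _ k (I f')).
have ID f1 f2 : mu.-integrable setT (EFin \o (fun x => W f1 x + W f2 x)).
  exact: (integrableD _ (I f1) (I f2)).
have IZD k f1 f2 : mu.-integrable setT (EFin \o (fun x => k * (W f1 x + W f2 x))).
  exact: (integrableZl _ k (ID f1 f2)).
rewrite mulrA -!RintegralD// -!RintegralZl// -!RintegralD//.
apply: le_Rintegral => //.
- exact: (integrableD _ (IZ _ _) (IZ _ _)).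
- exact: (integrableD _ (IZD _ _ _) (IZD _ _ _)).
- move=> x _; rewrite -mulrA.
  exact: (modulus_second_difference p2 (f x) (g x) t n0 pP cE).
Qed.

(** At every point at most one of the two functions contributes, so the integrals of the [p]-th
    powers add up. *)
Lemma rnorm_disjoint f g (t : K) : (forall x, f x = 0 \/ g x = 0) ->
  rnorm (\pi_Lp f + t *: \pi_Lp g)%qT `^ p =
  rnorm (\pi_Lp f)%qT `^ p + modulus t `^ p * rnorm (\pi_Lp g)%qT `^ p.
Proof.
move=> fg.
have -> : (t *: \pi_Lp g = \pi_Lp (t *: g))%qT by exact: Lp_scaleE.
have -> : (\pi_Lp f + \pi_Lp (t *: g) = \pi_Lp (f + t *: g))%qT
  by exact: Lp_addE.
have I := integrable_powR_modulus.
rewrite !rnorm_pi -RintegralZl// -RintegralD//; last first.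
  exact: (integrableZl _ (modulus t `^ p) (I g)).
apply: eq_Rintegral => x _; rewrite /powR_modulus.
rewrite [Lp_val _ x in LHS](_ : _ = f x + t * g x)//.
have [fx|gx] := fg x; rewrite ?fx ?gx modulus0 powR0 ?gt_eqF//.
  by rewrite !add0r -powRM ?modulus_ge0// -modulusM.
by rewrite !mulr0 !addr0.
Qed.

End LpNorm.

(** * Atoms and the existence of a disjointly supported pair *)

Section ZeroOne.
Context d (T : measurableType d) (R : realType) (mu : {measure set T -> \bar R}).

(** The constant is the essential supremum of [u / v] on [S], that is the infimum of the [c] with
    [u <= c v] almost everywhere on [S]; since [S] is not negligible, the set of these [c] is
    nonempty and bounded below. For [c] below the infimum the dichotomy gives [u > c v] almost
    everywhere, so the ratio is squeezed between two sequences tending to the infimum. *)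
Lemma zero_one_constant_ratio (S : set T) (u v : T -> R) :
  measurable S -> ~ mu.-negligible S ->
  measurable_fun setT u -> measurable_fun setT v ->
  (forall x, S x -> 0 < v x) ->
  (forall E, measurable E -> mu.-negligible (S `&` E) \/ mu.-negligible (S `\` E)) ->
  exists c, mu.-negligible (S `&` [set x | u x <> c * v x]).
Proof.
move=> mS nS mu' mv v0 zo.
pose H c := [set x | c * v x < u x].
have mH c : measurable (H c).
  have -> : H c = (fun x => u x - c * v x) @^-1` `]0, +oo[%classic.
    by apply/seteqP; split=> x; rewrite /H/= in_itv/= andbT subr_gt0.
  rewrite -[_ @^-1` _]setTI; apply: measurable_funB => //.
  exact: measurable_funM.
pose A := [set c | mu.-negligible (S `&` H c)].
have notA c : ~ A c -> mu.-negligible (S `\` H c).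
  by move=> Ac; case: (zo _ (mH c)).
have bigA (G : nat -> set T) : (forall k, mu.-negligible (G k)) ->
    mu.-negligible (\bigcup_k G k) by exact: negligible_bigcup.
have A0 : A !=set0.
  apply: contrapT => An; apply: nS.
  apply: (negligibleS _ (bigA (fun k => S `\` H k%:R) _)) => [x Sx|k].
    exists (Num.truncn (u x / v x)).+1 => //; split => //; apply/negP; rewrite -leNgt.
    by rewrite -ler_pdivrMr ?v0// ltW// truncnS_gt.
  by apply: notA => Ak; apply: An; exists k%:R.
have Alb : has_lbound A.
  apply: contrapT => Alb; apply: nS.
  apply: (negligibleS _ (bigA (fun k => S `&` H (- k%:R)) _)) => [x Sx|k].
    exists (Num.truncn (- u x / v x)).+1 => //; split => //; rewrite /H/=.
    rewrite mulNr ltrNl -ltr_pdivrMr ?v0//; exact: truncnS_gt.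
  have [c Ac ck] : exists2 c, A c & c < - k%:R.
    apply: contrapT => h; apply: Alb; exists (- k%:R) => c Ac.
    by rewrite leNgt; apply/negP => ck; apply: h; exists c.
  apply: (negligibleS _ Ac) => x [Sx kx]; split => //.
  by apply: le_lt_trans kx; rewrite ler_wpM2r ?ltW// v0.
exists (inf A).
have infA : has_inf A by split.
pose e (k : nat) : R := k.+1%:R^-1.
have e0 k : 0 < e k by rewrite invr_gt0.
apply: (negligibleS _ (bigA (fun k =>
  (S `&` H (inf A + e k)) `|` (S `\` H (inf A - e k))) _)) => [x [Sx /eqP ux]|k].
  pose r := u x / v x - inf A.
  have r0 : 0 < `|r|.
    rewrite normr_gt0 subr_eq0; apply: contra ux => /eqP <-.
    by rewrite divfK// gt_eqF// v0.
  have [k kr] : exists k, e k < `|r|.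
    exists (Num.truncn `|r|^-1); rewrite /e -[ltRHS]invrK ltf_pV2 ?posrE ?invr_gt0//.
    exact: truncnS_gt.
  exists k => //; have [rp|rn] := leP 0 r.
    left; split => //; rewrite /H/= -ltr_pdivlMr ?v0// addrC -ltrBrDr.
    by rewrite ger0_norm in kr.
  right; split => //; apply/negP; rewrite -leNgt -ler_pdivrMr ?v0//.
  by rewrite ltr0_norm// /r in kr; move: kr; lra.
apply: negligibleU.
  have [c Ac cr] := inf_adherent (e0 k) infA.
  apply: (negligibleS _ Ac) => x [Sx hx]; split => //.
  by apply: lt_trans hx; rewrite ltr_pM2r ?v0.
apply: notA => Ak; have := ge_inf Alb Ak; have := e0 k; lra.
Qed.

End ZeroOne.

(** The two left-hand sides are the real and imaginary parts of [b] times the conjugate of [a],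
    hence [z = c1 + i c2] is the quotient [b / a]. In this form the ratio of two scalar functions is
    handled by real functions, over the common denominator [|a|^2]. *)
Lemma scalar_ratio (R : realType) (F : scalar_field) (c1 c2 : R) :
  exists z : scalars R F, forall a b, a <> 0 ->
    sRe a * sRe b + sIm a * sIm b = c1 * modulus a ^+ 2 ->
    sRe a * sIm b - sIm a * sRe b = c2 * modulus a ^+ 2 -> b = z * a.
Proof.
pose z : scalars R F := match F return scalars R F with
  RealScalars => c1 | ComplexScalars => (c1 +i* c2)%C end.
exists z => a b a0.
have {}a0 : a != 0 by apply/eqP.
rewrite modulusE sqr_sqrtr ?addr_ge0 ?sqr_ge0//.
rewrite {}/z; case: F a b a0 => /= [a b a0 h _|[ar ai] [br bi] a0 h1 h2].
  apply: (mulfI a0); move: h; lra.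
have D0 : ar ^+ 2 + ai ^+ 2 != 0.
  by rewrite paddr_eq0 ?sqr_ge0// !sqrf_eq0; apply: contra a0; rewrite eq_complex.
apply/eqP; rewrite eq_complex /=; apply/andP; split; apply/eqP; apply: (mulfI D0).
  transitivity ((ar * br + ai * bi) * ar - (ar * bi - ai * br) * ai); first by ring.
  by rewrite h1 h2 /=; ring.
transitivity ((ar * br + ai * bi) * ai + (ar * bi - ai * br) * ar); first by ring.
by rewrite h1 h2 /=; ring.
Qed.

Section Disjoint.
Context d (T : measurableType d) (R : realType).
Variables (F : scalar_field) (mu : {measure set T -> \bar R}).
Variables (p : R) (p2 : 2 <= p).
Local Notation K := (scalars R F).
Local Notation p1 := (ge2_ge1 p2).
Local Notation Lp := (Lp F mu p1).
Local Notation Lp_fun := (Lp_fun F mu p1).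
Implicit Types f g : Lp_fun.

Let p0 : 0 < p. Proof. exact: lt_le_trans p2. Qed.

Lemma smeasurable_restrict (f : T -> K) (E : set T) :
  measurable E -> smeasurable f -> smeasurable (f \_ E).
Proof.
move=> mE [mr mi]; split.
  have -> : @sRe R F \o (f \_ E) = (@sRe R F \o f) \_ E.
    by apply/funext => x; rewrite /= !patchE; case: ifP => // _; rewrite /sRe; case: F.
  by apply/(measurable_restrictT _ _).1 => //; exact: measurable_funS mr.
have -> : @sIm R F \o (f \_ E) = (@sIm R F \o f) \_ E.
  by apply/funext => x; rewrite /= !patchE; case: ifP => // _; rewrite /sIm; case: F.
by apply/(measurable_restrictT _ _).1 => //; exact: measurable_funS mi.
Qed.

Lemma Lp_restrict_subproof f (E : set T) : measurable E ->
  (f \_ E : T -> K) \in Lp_pred mu p1.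
Proof.
move=> mE; apply/Lp_predP; have mf := Lp_fun_smeasurable f.
split; first exact: smeasurable_restrict.
apply: le_lt_trans (Lp_fun_fin f); apply: le_sLnorm => //.
- exact: smeasurable_restrict.
- exact: smeasurable_modulus.
- move=> x /=; rewrite patchE; case: ifP => // _; by rewrite modulus0 modulus_ge0.
Qed.

Definition Lp_restrict f (E : set T) (mE : measurable E) : Lp_fun :=
  LpFun (Lp_restrict_subproof f mE).

Lemma pi_eq0 f : (\pi_Lp f = 0 :> Lp)%qT -> mu.-negligible [set x | f x <> 0].
Proof.
move=> /Lp_eqP f0; apply: negligibleS f0 => x fx /=; by apply/not_implyP; split.
Qed.

(** Without such a pair, the support [S] of [f] is an atom: the restrictions of [f] to [E] and to
    its complement are disjoint, so one of them is zero. For the same reason [g] vanishes almost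
    everywhere off [S]. On an atom the ratio [g / f] is almost everywhere constant, so [g] is a
    multiple of [f], against independence. *)
Lemma dim_ge2_disjoint : dim_ge2 Lp -> exists f g,
  [/\ forall x, f x = 0 \/ g x = 0, (\pi_Lp f)%qT != 0 :> Lp
     & (\pi_Lp g)%qT != 0 :> Lp].
Proof.
move=> [X [Y]]; elim/Lp_ind: X => f; elim/Lp_ind: Y => g XY.
apply: contrapT => nodisj.
have disj f1 f2 : (forall x, f1 x = 0 \/ f2 x = 0) ->
    mu.-negligible [set x | f1 x <> 0] \/ mu.-negligible [set x | f2 x <> 0].
  move=> f12.
  have [/pi_eq0|f1n0] := eqVneq (\pi_Lp f1 : Lp)%qT 0; first by left.
  have [/pi_eq0|f2n0] := eqVneq (\pi_Lp f2 : Lp)%qT 0; first by right.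
  by exfalso; apply: nodisj; exists f1, f2.
pose S := [set x | f x <> 0].
have mf := Lp_fun_smeasurable f; have mg := Lp_fun_smeasurable g.
pose v x := modulus (f x) ^+ 2.
have mv : measurable_fun setT v.
  by apply: measurable_funX; exact: smeasurable_modulus.
have SE : S = v @^-1` `]0, +oo[%classic.
  apply/seteqP; split=> x; rewrite /S/= in_itv/= andbT /v.
    move=> fx; rewrite exprn_gt0// lt0r modulus_ge0 andbT.
    by apply/negP => /eqP /modulus_eq0.
  by move=> vx fx; move: vx; rewrite fx modulus0 expr0n ltxx.
have mS : measurable S by rewrite SE -[_ @^-1` _]setTI; exact: mv.
have v0 x : S x -> 0 < v x by rewrite SE /= in_itv/= andbT.
have nS : ~ mu.-negligible S.
  move=> nS.
  have f0 : (\pi_Lp f = 0 :> Lp)%qT.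
    apply/Lp_eqP; apply: negligibleS nS => x /= h fx0; apply: h => _; exact: fx0.
  have [] := XY 1 0; first by rewrite f0 scaler0 scale0r addr0.
  by move=> /eqP; rewrite oner_eq0.
have zo E : measurable E -> mu.-negligible (S `&` E) \/ mu.-negligible (S `\` E).
  move=> mE.
  have := disj (Lp_restrict f mE) (Lp_restrict f (measurableC mE)).
  case=> [x /=|n|n]; [|left|right].
  - rewrite !patchE in_setC; case: (x \in E); by [right|left].
  - by apply: negligibleS n => x [Sx Ex] /=; rewrite patchE mem_set.
  - by apply: negligibleS n => x [Sx Ex] /=; rewrite patchE mem_set.
have gS : mu.-negligible [set x | f x = 0 /\ g x <> 0].
  have := disj f (Lp_restrict g (measurableC mS)).
  case=> [x /=|/nS//|n].
    have [fx|Sx] := pselect (f x = 0); first by left.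
    by right; rewrite patchE in_setC mem_set.
  apply: negligibleS n => x [fx gx] /=; rewrite patchE mem_set//.
have [mfr mfi] := mf; have [mgr mgi] := mg.
pose u1 x := sRe (f x) * sRe (g x) + sIm (f x) * sIm (g x).
pose u2 x := sRe (f x) * sIm (g x) - sIm (f x) * sRe (g x).
have mu1 : measurable_fun setT u1.
  by apply: measurable_funD; apply: measurable_funM.
have mu2 : measurable_fun setT u2.
  by apply: measurable_funB; apply: measurable_funM.
have [c1 n1] := zero_one_constant_ratio mS nS mu1 mv v0 zo.
have [c2 n2] := zero_one_constant_ratio mS nS mu2 mv v0 zo.
have [z zE] : exists z : K, forall x, S x -> u1 x = c1 * v x -> u2 x = c2 * v x ->
    g x = z * f x.
  have [z zE] := scalar_ratio F c1 c2.
  by exists z => x Sx e1 e2; exact: zE.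
have gz : (\pi_Lp g = \pi_Lp (z *: f) :> Lp)%qT.
  apply/Lp_eqP.
  apply: (negligibleS _ (negligibleU gS (negligibleU n1 n2))) => x /= h.
  have [fx|fx] := pselect (f x = 0).
    left; split=> // gx; apply: h => _; rewrite gx.
    by rewrite [RHS](_ : _ = z * f x)// fx mulr0.
  right; have [e1|e1] := pselect (u1 x = c1 * v x); last by left.
  right; split => // e2; apply: h => _; rewrite (zE x)//.
have [] := XY (- z) 1.
  rewrite gz scale1r scaleNr.
  have -> : (z *: \pi_Lp f = \pi_Lp (z *: f))%qT by exact: Lp_scaleE.
  by rewrite addNr.
by move=> _ /eqP; rewrite oner_eq0.
Qed.

(** After normalization the disjoint pair spans a copy of the two-dimensional space of [p]-summable
    pairs; [t = 0] gives that [u] is a unit vector too. *)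
Lemma dim_ge2_lp2_pair : dim_ge2 Lp -> exists u v : Lp,
  rnorm v = 1 /\ forall t : K, rnorm (u + t *: v) `^ p = 1 + modulus t `^ p.
Proof.
move=> /dim_ge2_disjoint[f [g [fg f0 g0]]].
pose a (x : Lp) : K := `|x|^-1.
have a1 (x : Lp) : x != 0 -> rnorm (a x *: x) = 1.
  move=> x0; apply: (@of_real_inj R F); rewrite of_real_rnorm normrZ.
  rewrite normfV normr_id mulVf ?normr_eq0//.
  by rewrite /of_real; case: F.
exists (a (\pi_Lp f)%qT *: (\pi_Lp f)%qT), (a (\pi_Lp g)%qT *: (\pi_Lp g)%qT).
split; first exact: a1.
move=> t.
pose f' : Lp_fun := a (\pi_Lp f)%qT *: f.
pose g' : Lp_fun := a (\pi_Lp g)%qT *: g.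
have Ef : (a (\pi_Lp f) *: \pi_Lp f = \pi_Lp f')%qT by exact: Lp_scaleE.
have Eg : (a (\pi_Lp g) *: \pi_Lp g = \pi_Lp g')%qT by exact: Lp_scaleE.
have := a1 _ f0; have := a1 _ g0; rewrite Ef Eg => g1 f1.
rewrite (@rnorm_disjoint _ _ _ _ _ _ p2 f' g' t).
  by rewrite f1 g1 powR1 mulr1.
move=> x; have [fx|gx] := fg x; [left|right].
  by rewrite [LHS](_ : _ = a (\pi_Lp f)%qT * f x)// fx mulr0.
by rewrite [LHS](_ : _ = a (\pi_Lp g)%qT * g x)// gx mulr0.
Qed.

End Disjoint.

(** * The acceptance test *)

(* [x1], ..., [x6] stand for [D] times the norms of [u], [v], [N u + v],
   [N u - v], [u + v], [u - v], up to an error of [2].  The first four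
   conditions place the norms of [u] and [v] in [[1, 1 + 1/n]]; the next two
   make the second difference in the direction [v / N] small; the last three
   say that [|u + v|^a, |u - v|^a < 2^b] and
   [2^b < (|u + v| / (1 + 1/n)^3)^(a + 2)], whence [a < p b < a + 2]. *)
Definition accepts (P b D n N a x1 x2 x3 x4 x5 x6 : nat) : bool :=
  let c := (n * n.+1 ^ (P + 2) * N ^ 2)%N in
  [&& (D + 2 <= x1)%N, (D + 2 <= x2)%N,
      (n * (x1 + 2) <= n.+1 * D)%N, (n * (x2 + 2) <= n.+1 * D)%N,
      (c * (x3 + 2) ^ P <= (2 + c) * (N * D) ^ P)%N,
      (c * (x4 + 2) ^ P <= (2 + c) * (N * D) ^ P)%N,
      ((x5 + 2) ^ a < 2 ^ b * D ^ a)%N, ((x6 + 2) ^ a < 2 ^ b * D ^ a)%N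
    & (2 ^ b * (D * n.+1 ^ 3) ^ (a + 2) < ((x5 - 2) * n ^ 3) ^ (a + 2))%N].

(** * Soundness of the test *)

Section Accepts.
Variables (R : realType) (p : R).
Hypothesis p2 : 2 <= p.

Let p0 : 0 <= p. Proof. by apply: le_trans p2. Qed.

(** If [p b <= m], then [M^m >= M^(p b) >= 2^b], where [M >= 1] is forced by [M^p >= 2]. *)
Lemma exponent_gt (M : R) (m b : nat) : 0 <= M -> 2 <= M `^ p ->
  M ^+ m < 2 ^+ b -> m%:R < p * b%:R.
Proof.
move=> M0 Mp Mm; rewrite ltNge; apply/negP => pm; move: Mm; rewrite ltNge => /negP; apply.
have M1 : 1 <= M.
  rewrite leNgt; apply/negP => M1; have : M `^ p <= 1 `^ p.
    by rewrite ge0_ler_powR ?nnegrE// ltW.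
  rewrite powR1; lra.
rewrite -!powR_mulrn//; apply: le_trans (ler_powR M1 pm).
by rewrite powRrM ge0_ler_powR ?nnegrE ?powR_ge0.
Qed.

Lemma exponent_lt (r : R) (m b : nat) : 0 <= r -> r `^ p <= 2 ->
  2 ^+ b < r ^+ m -> p * b%:R < m%:R.
Proof.
move=> r0 rp rm; rewrite ltNge; apply/negP => pm; move: rm; rewrite ltNge => /negP; apply.
(* Raising the exponent increases the power only for a base at least [1]; below [1] the power does
   not even reach [1]. *)
have [r1|r1] := leP 1 r.
  rewrite -!powR_mulrn//; apply: le_trans (ler_powR r1 pm) _.
  by rewrite powRrM ge0_ler_powR ?nnegrE ?powR_ge0.
by apply: (@le_trans _ _ 1); rewrite ?exprn_ile1 ?exprn_ege1 ?ler1n// ltW.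
Qed.

(** The [r]s are the true norms and the [x]s their scaled approximations. Clarkson's inequality for
    norms at least [1] yields the lower bound on [p b]; the second difference, multiplied by [N^2],
    yields [r5^p <= 2 (1 + 1/n)^(3 p)] and with it the upper bound. *)
Lemma accepts_sound (P b D n N a x1 x2 x3 x4 x5 x6 : nat) (r1 r2 r3 r4 r5 r6 : R) :
  p <= P%:R -> (0 < D)%N -> (0 < n)%N -> (0 < N)%N ->
  (forall i, 0 <= tnth [tuple r1; r2; r3; r4; r5; r6] i) ->
  (forall i, let r := tnth [tuple r1; r2; r3; r4; r5; r6] i in
             let x := (tnth [tuple x1; x2; x3; x4; x5; x6] i)%:R in
             x - 2 <= D%:R * r <= x + 2) ->
  2 * (r1 `^ p + r2 `^ p) <= r5 `^ p + r6 `^ p ->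
  (forall c, c = (n.+1 ^ (P + 2))%:R ->
  N%:R^-1 ^+ 2 * r5 `^ p + c * r1 `^ p <=
  N%:R^-1 ^+ 2 * ((1 + n%:R^-1) `^ p * (r1 `^ p + r2 `^ p)) +
  c / 2 * ((N%:R^-1 * r3) `^ p + (N%:R^-1 * r4) `^ p)) ->
  accepts P b D n N a x1 x2 x3 x4 x5 x6 ->
  a%:R < p * b%:R < (a + 2)%:R.
Proof.
move=> pP D0 n0 N0 r0 rx clarkson second.
have r10 := r0 0; have r20 := r0 1; have r30 := r0 2.
have r40 := r0 3; have r50 := r0 4; have r60 := r0 5.
have rx1 := rx 0; have rx2 := rx 1; have rx3 := rx 2.
have rx4 := rx 3; have rx5 := rx 4; have rx6 := rx 5.
rewrite /= !(tnth_nth 0) /= in r10 r20 r30 r40 r50 r60.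
rewrite /= !(tnth_nth 0) ?(tnth_nth 0%N) /= in rx1 rx2 rx3 rx4 rx5 rx6.
clear r0 rx.
have {}D0 : 0 < D%:R :> R by rewrite ltr0n.
have {}n0 : 0 < n%:R :> R by rewrite ltr0n.
have {}N0 : 0 < N%:R :> R by rewrite ltr0n.
have eta0 : 0 < n%:R^-1 :> R by rewrite invr_gt0.
set h := n%:R^-1 : R in eta0 second *.
have nh : n%:R * h = 1 by rewrite mulfV// gt_eqF.
have h10 : 0 <= 1 + h by lra.
have monop (x y : R) : 0 <= x -> x <= y -> x `^ p <= y `^ p.
  by move=> x0 xy; rewrite ge0_ler_powR ?nnegrE// (le_trans x0).
move=> /and5P[a1 a2 a3 a4 /and5P[a5 a6 a7 a8 a9]].
have lower (x : nat) (r : R) : (D + 2 <= x)%N -> x%:R - 2 <= D%:R * r <= x%:R + 2 -> 1 <= r.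
  rewrite -(ler_nat R) natrD => Dx /andP[xr _].
  rewrite -(ler_pM2l D0) mulr1; lra.
have upper (x : nat) (r : R) : (n * (x + 2) <= n.+1 * D)%N ->
    x%:R - 2 <= D%:R * r <= x%:R + 2 -> r <= 1 + h.
  rewrite -(ler_nat R) !natrM natrD -[n.+1%:R]natr1 => Dx /andP[_ xr].
  rewrite -(ler_pM2l D0) -(ler_pM2l n0).
  have := ler_wpM2l (ltW n0) xr.
  have -> : n%:R * (D%:R * (1 + h)) = n%:R * D%:R + D%:R * (n%:R * h) by ring.
  rewrite nh; lra.
have s1 := monop _ _ ler01 (lower _ _ a1 rx1); rewrite powR1 in s1.
have s2 := monop _ _ ler01 (lower _ _ a2 rx2); rewrite powR1 in s2.
have t1 := monop _ _ r10 (upper _ _ a3 rx1).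
have t2 := monop _ _ r20 (upper _ _ a4 rx2).
apply/andP; split.
  have bound (x : nat) (r : R) : ((x + 2) ^ a < 2 ^ b * D ^ a)%N ->
      0 <= r -> x%:R - 2 <= D%:R * r <= x%:R + 2 -> r ^+ a < 2 ^+ b.
    rewrite -(ltr_nat R) natrM !natrX natrD => hx r0 /andP[_ xr].
    have Da : 0 < D%:R ^+ a :> R by rewrite exprn_gt0.
    rewrite -(ltr_pM2l Da) -exprMn [ltRHS]mulrC; apply: le_lt_trans hx.
    by rewrite lerXn2r ?nnegrE ?addr_ge0 ?mulr_ge0// ltW.
  (* Only the larger of the two is known to have a [p]-th power at least [2]; the test bounds both,
     as it cannot tell which one it is. *)
  have [r56|r56] := leP r5 r6.
    apply: (@exponent_gt r6) => //; last exact: bound a8 r60 rx6.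
    have := monop _ _ r50 r56; lra.
  apply: (@exponent_gt r5) => //; last exact: bound a7 r50 rx5.
  have := monop _ _ r60 (ltW r56); lra.
set C : R := (n.+1 ^ (P + 2))%:R in second.
have C0 : 0 < C by rewrite ltr0n expn_gt0.
have near (x : nat) (r : R) :
    (n * n.+1 ^ (P + 2) * N ^ 2 * (x + 2) ^ P <=
     (2 + n * n.+1 ^ (P + 2) * N ^ 2) * (N * D) ^ P)%N ->
    0 <= r -> x%:R - 2 <= D%:R * r <= x%:R + 2 ->
    C * N%:R ^+ 2 * (N%:R^-1 * r) `^ p <= C * N%:R ^+ 2 + 2 * h.
  rewrite -(ler_nat R) !natrM natrD !natrM -/C !natrX natrD natrM => hx r0 /andP[_ xr].
  set c := C * N%:R ^+ 2.
  have c0 : 0 < c by rewrite mulr_gt0// exprn_gt0.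
  have s0 : 0 <= N%:R^-1 * r by rewrite mulr_ge0// invr_ge0 ltW.
  (* The test controls the power [P], which dominates the power [p] only for bases above [1]; below
     [1] the claim is immediate. *)
  have [sle1|sgt1] := leP (N%:R^-1 * r) 1.
    have := monop _ _ s0 sle1; rewrite powR1 => /(ler_wpM2l (ltW c0)); lra.
  have := ler_powR (ltW sgt1) pP; rewrite powR_mulrn// => /(ler_wpM2l (ltW c0)) sP.
  apply: le_trans sP _.
  have ND : 0 < (N%:R * D%:R) ^+ P :> R by rewrite exprn_gt0// mulr_gt0.
  rewrite -(ler_pM2l ND) -(ler_pM2l n0).
  have -> : n%:R * ((N%:R * D%:R) ^+ P * (c * (N%:R^-1 * r) ^+ P)) =
            n%:R * C * N%:R ^+ 2 * (D%:R * r) ^+ P.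
    have -> : D%:R * r = (N%:R * D%:R) * (N%:R^-1 * r).
      by rewrite mulrACA mulfV ?gt_eqF// mul1r.
    by rewrite [in RHS]exprMn /c; ring.
  have xP : (D%:R * r) ^+ P <= (x%:R + 2) ^+ P.
    by rewrite lerXn2r ?nnegrE ?addr_ge0 ?mulr_ge0// ltW.
  have k0 : 0 <= n%:R * C * N%:R ^+ 2 by rewrite !mulr_ge0 ?exprn_ge0// ltW.
  apply: le_trans (ler_wpM2l k0 xP) _; apply: le_trans hx _.
  rewrite le_eqVlt; apply/orP; left; apply/eqP; rewrite /c.
  have -> : n%:R * ((N%:R * D%:R) ^+ P * (C * N%:R ^+ 2 + 2 * h)) =
    (N%:R * D%:R) ^+ P * (n%:R * C * N%:R ^+ 2 + 2 * (n%:R * h)) by ring.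
  rewrite nh; ring.
have near3 := near _ _ a5 r30 rx3; have near4 := near _ _ a6 r40 rx4.
have N2 : 0 < N%:R ^+ 2 :> R by rewrite exprn_gt0.
(* Origin of the exponent [3], with [E = (1 + h)^p]: one factor [E] comes from the inequality, one
   from [r1^p, r2^p <= E], and the third absorbs the tolerance [2 h] of the second difference,
   because [E >= 1 + h]. *)
have r5p : r5 `^ p <= 2 * ((1 + h) ^+ 3) `^ p.
  have {}second := second C erefl.
  have : r5 `^ p + C * N%:R ^+ 2 * r1 `^ p <=
    (1 + h) `^ p * (r1 `^ p + r2 `^ p) +
    C * N%:R ^+ 2 / 2 * ((N%:R^-1 * r3) `^ p + (N%:R^-1 * r4) `^ p).
    have := ler_wpM2l (ltW N2) second.
    rewrite exprVn !mulrDr !mulrA mulfV ?gt_eqF// !mul1r.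
    by rewrite !(mulrC (N%:R ^+ 2) C); lra.
  have E0 : 1 + h <= (1 + h) `^ p.
    rewrite -[leLHS](powRr1 h10) ler_powR//; first lra.
    by apply: le_trans p2; lra.
  rewrite (_ : ((1 + h) ^+ 3) `^ p = ((1 + h) `^ p) ^+ 3); last first.
    by rewrite -[(1 + h) ^+ 3]powR_mulrn// powRAC powR_mulrn ?powR_ge0.
  set E := (1 + h) `^ p in E0 t1 t2 *.
  set c := C * N%:R ^+ 2 in near3 near4 *.
  have c0 : 0 < c by rewrite mulr_gt0.
  move: near3 near4.
  have cs1 := ler_wpM2l (ltW c0) s1.
  have t12 : E * (r1 `^ p + r2 `^ p) <= E * (2 * E).
    apply: ler_wpM2l; [exact: powR_ge0|lra].
  have E3 : E * (2 * E) + 2 * h <= 2 * E ^+ 3.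
    have e : 2 * E ^+ 3 - E * (2 * E) = 2 * (E ^+ 2 * (E - 1)) by ring.
    have : E - 1 <= E ^+ 2 * (E - 1).
      by rewrite ler_peMl ?subr_ge0// ?exprn_ege1//; lra.
    lra.
  lra.
have H0 : 0 < (1 + h) ^+ 3 by rewrite exprn_gt0//; lra.
apply: (@exponent_lt (r5 / (1 + h) ^+ 3)).
- by rewrite divr_ge0// ltW.
- rewrite powRM ?invr_ge0 ?(ltW H0)// -powR_inv1 ?(ltW H0)// powRAC.
  by rewrite powR_inv1 ?powR_ge0// ler_pdivrMr// powR_gt0.
- have {}a9 : 2 ^+ b * (D%:R * n.+1%:R ^+ 3) ^+ (a + 2) <
      ((x5 - 2)%:R * n%:R ^+ 3) ^+ (a + 2) :> R.
    by move: a9; rewrite -(ltr_nat R) natrM (natrX _ 2) (natrX _ (_ * _))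
      (natrX _ (_ * _)) (natrM _ D) (natrM _ (x5 - 2)) (natrX _ n.+1) (natrX _ n).
  (* The subtraction is truncated, so a useless negative lower bound becomes [0], still below the
     norm. *)
  have x5r : (x5 - 2)%:R <= D%:R * r5.
    have [x52|/ltnW x52] := leqP 2 x5; first by rewrite natrB//; case/andP: rx5.
    by rewrite (eqP x52) mulr_ge0// ltW.
  have K0 : 0 < (D%:R * n%:R ^+ 3) ^+ (a + 2) :> R.
    by rewrite exprn_gt0// mulr_gt0// exprn_gt0.
  have H3 : 0 < ((1 + h) ^+ 3) ^+ (a + 2) by rewrite exprn_gt0.
  rewrite expr_div_n ltr_pdivlMr// -(ltr_pM2l K0).
  have nE : n.+1%:R = n%:R * (1 + h) :> R by rewrite mulrDr mulr1 nh natr1.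
  have -> : (D%:R * n%:R ^+ 3) ^+ (a + 2) * (2 ^+ b * ((1 + h) ^+ 3) ^+ (a + 2)) =
    2 ^+ b * (D%:R * n.+1%:R ^+ 3) ^+ (a + 2).
    by rewrite mulrCA -exprMn nE; congr (_ * _ ^+ _); rewrite exprMn -mulrA.
  apply: lt_le_trans a9 _; rewrite -exprMn lerXn2r ?nnegrE ?mulr_ge0 ?exprn_ge0 ?(ltW D0)//.
  by rewrite mulrAC ler_wpM2r// exprn_ge0.
Qed.

End Accepts.

(** * Completeness of the test *)

Section AcceptsComplete.
Variables (R : realType) (p : R).
Implicit Types x y z e : R.

Lemma exprn_lt_near x y m : 0 <= x -> x ^+ m < y ->
  exists2 e, 0 < e & forall z, 0 <= z -> z <= x + e -> z ^+ m < y.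
Proof.
move=> x0 xy.
have : (z ^+ m) @[z --> x] --> x ^+ m by exact: exprn_continuous.
move=> /cvgr_lt/(_ _ xy)/nbhs_ballP[e /= e0 he].
exists (e / 2); first by rewrite divr_gt0.
move=> z z0 zx; apply: (@le_lt_trans _ _ ((x + e / 2) ^+ m)).
  by rewrite lerXn2r ?nnegrE// (le_trans z0).
apply: he; rewrite /ball/= opprD addNKr normrN gtr0_norm ?divr_gt0//; lra.
Qed.

Lemma exprn_gt_near x y m : 0 <= x -> y < x ^+ m ->
  exists2 e, 0 < e & forall z, 0 <= z -> x - e <= z -> y < z ^+ m.
Proof.
move=> x0 xy.
have : (z ^+ m) @[z --> x] --> x ^+ m by exact: exprn_continuous.
move=> /cvgr_gt/(_ _ xy)/nbhs_ballP[e /= e0 he].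
exists (e / 2); first by rewrite divr_gt0.
move=> z z0 zx; apply: (@lt_le_trans _ _ (Num.max 0 (x - e / 2) ^+ m)).
  apply: he; rewrite /ball/=.
  by rewrite ger0_norm; case: (leP 0 (x - e / 2)); lra.
by rewrite lerXn2r ?nnegrE ?le_max ?lexx// ge_max z0.
Qed.

(** By convexity, the power lies below its chord on [[1, 2]]. *)
Lemma exprD1_le y m : 0 <= y <= 1 -> (1 + y) ^+ m <= 1 + (2 ^+ m - 1) * y.
Proof.
move=> /andP[y0 y1]; elim: m => [|m IH]; first by rewrite !expr0; lra.
rewrite exprSr; apply: le_trans (ler_wpM2r _ IH) _; first lra.
rewrite exprSr; have : 1 <= 2 ^+ m :> R by rewrite exprn_ege1// ler1n.
set t := 2 ^+ m => t1.
have : 0 <= (t - 1) * (y * (1 - y)) by rewrite !mulr_ge0 ?subr_ge0.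
lra.
Qed.

Lemma exists_inv_le (e : R) : 0 < e -> exists2 n : nat, (0 < n)%N & n%:R^-1 <= e.
Proof.
move=> e0; exists (Num.truncn e^-1).+1 => //.
by rewrite -[leRHS]invrK lef_pV2 ?posrE ?invr_gt0// ltW// truncnS_gt.
Qed.

Lemma powR2_lt x y : x < y -> 2 `^ x < 2 `^ y :> R.
Proof. by move=> xy; rewrite /powR gt_eqF// ltr_expR ltr_pM2r// ln_gt0// ltr1n. Qed.

Hypothesis p2 : 2 < p.

(** Here [g] and [X] are the norms of [u + v] and [u + v / N] for disjoint unit vectors. The order
    of choices matters: [a] from [p b], [n] from the strict gap [2^b < g^(a+2)], [N] from the
    constant determined by [n], and the precision from all remaining margins. *)
Lemma accepts_complete (P b : nat) : p <= P%:R -> (0 < b)%N ->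
  let g := 2 `^ p^-1 in
  exists a n N J0 : nat, [/\ (0 < n)%N, (0 < N)%N &
    forall J x1 x2 x3 x4 x5 x6 : nat, (J0 <= J)%N ->
    let D := (2 ^ J)%N in
    let X := (1 + N%:R^-1 `^ p) `^ p^-1 in
    (D + 2 <= x1 <= D + 13)%N -> (D + 2 <= x2 <= D + 13)%N ->
    (x3 + 2)%:R <= N%:R * (D%:R * X + 26) ->
    (x4 + 2)%:R <= N%:R * (D%:R * X + 26) ->
    (x5 + 2)%:R <= D%:R * g + 26 -> (x6 + 2)%:R <= D%:R * g + 26 ->
    D%:R * g <= x5%:R + 2 ->
    accepts P b D n N a x1 x2 x3 x4 x5 x6].
Proof.
move=> pP b0 g.
have p0 : 0 < p by move: p2; lra.
have g0 : 0 <= g by exact: powR_ge0.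
have pb0 : 0 < p * b%:R by rewrite mulr_gt0// ltr0n.
have [a apb pba] : exists2 a : nat, a%:R < p * b%:R & p * b%:R < (a + 2)%:R.
  have := truncn_itv (ltW pb0); set m := Num.truncn _ => /andP[mp pm].
  (* If [p b] is an integer, its integer part violates the strict lower inequality, and [a] is taken
     one below. *)
  have [e|mpb] := eqVneq m%:R (p * b%:R).
    have m0 : (0 < m)%N by rewrite -(ltr_nat R) e.
    by exists m.-1; rewrite -e ltr_nat ?prednK// addn2 prednK.
  exists m; first by rewrite lt_neqAle mpb.
  by apply: lt_trans pm _; rewrite ltr_nat addn2.
have gE m : g ^+ m = 2 `^ (m%:R / p).
  by rewrite -powR_mulrn// -powRrM mulrC.
have ga : g ^+ a < 2 ^+ b.
  by rewrite gE -powR_mulrn//; apply: powR2_lt; rewrite ltr_pdivrMr// mulrC.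
have ga2 : 2 ^+ b < g ^+ (a + 2).
  by rewrite gE -powR_mulrn//; apply: powR2_lt; rewrite ltr_pdivlMr// mulrC.
have [n n0 hn] : exists2 n : nat, (0 < n)%N &
    2 ^+ b * ((1 + n%:R^-1) ^+ 3) ^+ (a + 2) < g ^+ (a + 2).
  have h : 1 ^+ (3 * (a + 2)) < g ^+ (a + 2) / 2 ^+ b.
    by rewrite expr1n ltr_pdivlMr ?mul1r// exprn_gt0.
  have [e e0 he] := exprn_lt_near ler01 h.
  have [n n0 ne] := exists_inv_le e0; exists n => //.
  rewrite -exprM mulrC -ltr_pdivlMr ?exprn_gt0//.
  by apply: he; rewrite ?lerD2l// addr_ge0// invr_ge0.
pose C : R := (n * n.+1 ^ (P + 2))%:R.
have C0 : 0 < C by rewrite ltr0n muln_gt0 n0 expn_gt0.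
have [N N0 hN] : exists2 N : nat, (0 < N)%N &
    ((1 + N%:R^-1 `^ p) `^ p^-1) ^+ P < (2 + C * N%:R ^+ 2) / (C * N%:R ^+ 2).
  (* The chord bound gives [X^P <= 1 + 2^P N^(-p)], whereas the test tolerates an excess
     [2 / (C N^2)]; hence [N^(p-2) > C 2^P] is enough, and [p > 2] makes such an [N] exist. *)
  pose K : R := C * 2 ^+ P.
  have K0 : 0 < K by rewrite mulr_gt0// exprn_gt0.
  have q0 : 0 < p - 2 by rewrite subr_gt0.
  pose N := (Num.truncn (K `^ (p - 2)^-1)).+1; exists N => //.
  have N0 : 0 < N%:R :> R by rewrite ltr0n.
  have KN : K < N%:R `^ (p - 2).
    have KE : K = (K `^ (p - 2)^-1) `^ (p - 2).
      by rewrite -powRrM mulVf ?gt_eqF// powRr1// ltW.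
    rewrite [ltLHS]KE; apply: gt0_ltr_powR => //; rewrite ?nnegrE ?powR_ge0//.
    exact: truncnS_gt.
  set y := N%:R^-1 `^ p.
  have y0 : 0 < y by rewrite powR_gt0 ?invr_gt0.
  have y1 : y <= 1.
    have : y <= 1 `^ p.
      rewrite /y ge0_ler_powR ?nnegrE ?invr_ge0 ?(ltW p0)//.
      by rewrite invf_le1// ler1n.
    by rewrite powR1.
  have Ny : N%:R `^ (p - 2) * N%:R ^+ 2 * y = 1.
    rewrite -powR_mulrn ?ltW// -powRD ?(gt_eqF N0) ?implybT// subrK.
    by rewrite -powRM ?invr_ge0 ?ltW// mulfV ?gt_eqF// powR1.
  have Xy : ((1 + y) `^ p^-1) ^+ P <= 1 + 2 ^+ P * y.
    rewrite -powR_mulrn ?powR_ge0// -powRrM.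
    apply: (@le_trans _ _ ((1 + y) `^ P%:R)).
      apply: ler_powR; first by rewrite lerDl ltW.
      by rewrite mulrC ler_pdivrMr// ler_peMr//; move: p2; lra.
    rewrite powR_mulrn; last lra.
    apply: le_trans (exprD1_le P _) _; last by rewrite lerD2l ler_pM2r//; lra.
    by rewrite (ltW y0).
  apply: le_lt_trans Xy _.
  have N2 : 0 < N%:R ^+ 2 :> R by rewrite exprn_gt0.
  have c0 : 0 < C * N%:R ^+ 2 by rewrite mulr_gt0.
  rewrite ltr_pdivlMr// mulrDl mul1r addrC ltrD2r.
  have -> : 2 ^+ P * y * (C * N%:R ^+ 2) = K * (N%:R ^+ 2 * y) by rewrite /K; ring.
  apply: (@lt_trans _ _ 1) => //; last lra.
  by rewrite -[ltRHS]Ny -[ltRHS]mulrA; rewrite (ltr_pM2r (mulr_gt0 N2 y0)).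
have N0' : 0 < N%:R :> R by rewrite ltr0n.
set X := (1 + N%:R^-1 `^ p) `^ p^-1 in hN.
have [e3 e30 he3] := exprn_lt_near (powR_ge0 _ _) hN.
have [e5 e50 he5] := exprn_lt_near g0 ga.
have [e9 e90 he9] := exprn_gt_near g0 hn.
pose e := Num.min e3 (Num.min e5 e9).
have e0 : 0 < e by rewrite !lt_min e30 e50.
(* As [J < 2 ^ J = D], this ensures [15 n <= D], which is the bound on [x1] and [x2] with
   [15 = 13 + 2], and [26 <= D e], which fits the additive errors into the margin [e]. *)
exists a, n, N, (15 * n + (Num.truncn (26 / e)).+1)%N; split=> //.
move=> J x1 x2 x3 x4 x5 x6 J0J D X'; rewrite -/X {}/X'.
have D15 : (15 * n <= D)%N.
  by apply: leq_trans (ltnW (ltn_expl J _)) => //; apply: leq_trans J0J; exact: leq_addr.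
have D0 : 0 < D%:R :> R by rewrite ltr0n expn_gt0.
have DJ : (J < D)%N by exact: ltn_expl.
clearbody D.
have eD : 26 <= D%:R * e.
  rewrite -ler_pdivrMr//; apply: ltW; apply: lt_le_trans (truncnS_gt _) _.
  rewrite ler_nat; apply: leq_trans (ltnW DJ).
  by apply: leq_trans J0J; exact: leq_addl.
have [ee3 [ee5 ee9]] : e <= e3 /\ e <= e5 /\ e <= e9.
  by rewrite /e !ge_min !lexx ?orbT.
have scale (y : R) e' : e <= e' -> D%:R * y + 26 <= D%:R * (y + e').
  by move=> ee; rewrite mulrDr lerD2l (le_trans eD)// ler_pM2l.
move=> /andP[l1 u1] /andP[l2 u2] h3 h4 h5 h6 l5.
have small (x : nat) : (x <= D + 13)%N -> (n * (x + 2) <= n.+1 * D)%N.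
  move=> xD; apply: (@leq_trans (n * (D + 13 + 2))).
    by rewrite leq_mul2l leq_add2r xD orbT.
  by rewrite -addnA mulnDr mulSn addnC leq_add2r mulnC.
have near (x : nat) : (x + 2)%:R <= N%:R * (D%:R * X + 26) ->
    (n * n.+1 ^ (P + 2) * N ^ 2 * (x + 2) ^ P <=
     (2 + n * n.+1 ^ (P + 2) * N ^ 2) * (N * D) ^ P)%N.
  move=> hx.
  have ND0 : 0 < N%:R * D%:R :> R by rewrite mulr_gt0.
  have : ((x + 2)%:R / (N%:R * D%:R)) ^+ P < (2 + C * N%:R ^+ 2) / (C * N%:R ^+ 2).
    apply: he3; first by rewrite divr_ge0// ltW.
    rewrite ler_pdivrMr// mulrC -mulrA; apply: le_trans hx _.
    by rewrite ler_pM2l// scale.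
  have CN0 : 0 < C * N%:R ^+ 2 by rewrite mulr_gt0// exprn_gt0.
  rewrite expr_div_n ltr_pdivrMr ?exprn_gt0// mulrAC ltr_pdivlMr// => hx'.
  set c := (n * n.+1 ^ (P + 2) * N ^ 2)%N.
  have cE : c%:R = C * N%:R ^+ 2 by rewrite /c natrM natrX.
  rewrite -(ler_nat R) (natrM _ c) (natrM _ (2 + c)) natrD cE.
  rewrite (natrX _ (x + 2)) (natrX _ (N * D)) (natrM _ N).
  by rewrite mulrC ltW.
have bound (x : nat) : (x + 2)%:R <= D%:R * g + 26 -> ((x + 2) ^ a < 2 ^ b * D ^ a)%N.
  move=> hx.
  have : ((x + 2)%:R / D%:R) ^+ a < 2 ^+ b :> R.
    apply: he5; first by rewrite divr_ge0// ltW.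
    by rewrite ler_pdivrMr// mulrC (le_trans hx)// scale.
  rewrite expr_div_n ltr_pdivrMr ?exprn_gt0// => hx'.
  by rewrite -(ltr_nat R) natrM !natrX.
rewrite /accepts l1 l2 !small// !near// !bound//=.
have : 2 ^+ b * ((1 + n%:R^-1) ^+ 3) ^+ (a + 2) < ((x5 - 2)%:R / D%:R) ^+ (a + 2) :> R.
  apply: he9; first by rewrite divr_ge0// ltW.
  have x52 : x5%:R - 2 <= (x5 - 2)%:R :> R.
    have [x52|/ltnW x52] := leqP 2 x5; first by rewrite natrB.
    by rewrite (eqP x52) subr_le0 ler_nat.
  rewrite ler_pdivlMr// mulrBl.
  have : 26 <= e9 * D%:R by rewrite mulrC (le_trans eD)// ler_pM2l.
  rewrite (mulrC g); lra.
have n0' : 0 < n%:R :> R by rewrite ltr0n.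
rewrite expr_div_n ltr_pdivlMr ?exprn_gt0// => h9.
have K0 : 0 < (n%:R ^+ 3) ^+ (a + 2) :> R by rewrite !exprn_gt0.
rewrite -(ltr_nat R) natrM (natrX _ 2) (natrX _ (_ * _)) (natrX _ (_ * _)).
rewrite (natrM _ D) (natrM _ (x5 - 2)) (natrX _ n.+1) (natrX _ n).
have K4 (A B G u : R) k :
    u * (A * (B * G)) ^+ k = u * G ^+ k * A ^+ k * B ^+ k.
  by rewrite !exprMn; ring.
have nE : n.+1%:R = n%:R * (1 + n%:R^-1) :> R.
  by rewrite mulrDr mulr1 mulfV ?gt_eqF// natr1.
rewrite nE [(n%:R * _) ^+ 3]exprMn [ltRHS]exprMn.
by rewrite K4 ltr_pM2r.
Qed.

End AcceptsComplete.

(** * Rational vectors with a common denominator *)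

Section GaussianScalars.
Variables (R : realType) (F : scalar_field).
Local Notation K := (scalars R F).

(** The value [0] in the real case matches the imaginary part of a code being ignored there, so both
    fields share one formula for [gaussian]. *)
Definition imaginary_unit : K :=
  match F return scalars R F with RealScalars => 0 | ComplexScalars => 'i%C end.

Definition gaussian (a b c d : nat) : K :=
  a%:R - b%:R + imaginary_unit * (c%:R - d%:R).

(** With a single denominator, integral combinations of vectors only need sums and products of
    numerators, with no reduction of fractions. *)
Lemma scalar_of_code_gaussian a b c d m :
  scalar_of_code R F (CodeSeq.code
    [:: CodeSeq.code [:: a; b; m]; CodeSeq.code [:: c; d; m]]) =
  gaussian a b c d / m.+1%:R.
Proof.
have E (S : numFieldType) x y : ratr ((x%:Z - y%:Z)%:Q / m.+1%:R) =
    (x%:R - y%:R) / m.+1%:R :> S.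
  by rewrite fmorph_div/= ratr_int ratr_nat intrB.
have ratE x y : rat_of_code (CodeSeq.code [:: x; y; m]) =
    (x%:Z - y%:Z)%:Q / m.+1%:R by rewrite /rat_of_code CodeSeq.codeK.
rewrite /scalar_of_code CodeSeq.codeK.
rewrite -[LHS]/(rational_scalar R F
  (rat_of_code (CodeSeq.code [:: a; b; m]))
  (rat_of_code (CodeSeq.code [:: c; d; m]))).
rewrite !ratE /gaussian /imaginary_unit; case: F => /=.
  by rewrite E mul0r addr0.
rewrite !E [LHS]complexE /= [RHS]mulrDl; congr (_ + _).
  by rewrite rmorphM rmorphB fmorphV !rmorph_nat.
by rewrite rmorphM rmorphB fmorphV !rmorph_nat mulrA.
Qed.

Lemma modulus_real (x : R) : modulus (of_real F x) = `|x|.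
Proof. by rewrite modulusE /of_real /sRe /sIm; case: F => /=; rewrite expr0n addr0 sqrtr_sqr. Qed.

Lemma gaussian_approx (z : K) (m : nat) :
  exists abcd : nat * nat * nat * nat,
    modulus (z - gaussian abcd.1.1.1 abcd.1.1.2 abcd.1.2 abcd.2 / m.+1%:R)
    <= 2 / m.+1%:R.
Proof.
have ap (x : R) : exists a b : nat, `|x - (a%:R - b%:R) / m.+1%:R| <= m.+1%:R^-1.
  have m0 : 0 < m.+1%:R :> R by rewrite ltr0n.
  have [a [b ab]] : exists a b : nat, a%:R - b%:R = (Num.floor (x * m.+1%:R))%:~R :> R.
    case: (Num.floor _) => k; first by exists k, 0%N; rewrite subr0.
    by exists 0%N, k.+1; rewrite sub0r NegzE mulrNz.
  exists a, b; rewrite ab.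
  have -> : x - (Num.floor (x * m.+1%:R))%:~R / m.+1%:R =
    (x * m.+1%:R - (Num.floor (x * m.+1%:R))%:~R) / m.+1%:R.
    by rewrite mulrBl mulfK// gt_eqF.
  rewrite normrM normfV (gtr0_norm m0) ler_piMl ?invr_ge0 ?ltW//.
  have := Num.Theory.floor_itv (x * m.+1%:R).
  rewrite intrD => /andP[h1 h2].
  by rewrite ger0_norm; lra.
have [a [b ab]] := ap (sRe z); have [c [d cd]] := ap (sIm z).
exists (a, b, c, d) => /=.
have zE : z = of_real F (sRe z) + imaginary_unit * of_real F (sIm z).
  rewrite /of_real /imaginary_unit /sRe /sIm; case: F z {ab cd} => z.
    by rewrite mulr0 addr0.
  exact: complexE.
have nE (x y : nat) : (x%:R - y%:R) / m.+1%:R = of_real F ((x%:R - y%:R) / m.+1%:R) :> K.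
  rewrite /of_real; case: F => //=.
  by rewrite rmorphM rmorphB fmorphV !rmorph_nat.
have im1 : modulus imaginary_unit <= 1 :> R.
  rewrite modulusE /imaginary_unit /sRe /sIm; case: F => /=.
    by rewrite expr0n addr0 sqrtr0.
  by rewrite expr0n add0r expr1n sqrtr1.
rewrite {1}zE /gaussian mulrDl -mulrA !nE opprD addrACA -mulrBr.
apply: le_trans (modulusD _ _) _; rewrite modulusM.
have ofB (x y : R) : of_real F x - of_real F y = of_real F (x - y).
  by rewrite /of_real; case: F => //=; rewrite rmorphB.
rewrite !ofB !modulus_real.
have -> : 2 / m.+1%:R = m.+1%:R^-1 + m.+1%:R^-1 :> R by ring.
by apply: lerD => //; apply: le_trans cd; rewrite ler_piMl.
Qed.

End GaussianScalars.

(* A witness [w] codes a sequence of naturals: the number of vectors of the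
   presentation involved, the common denominator minus [1], the precision [j],
   [n - 1], [N - 1], [a], two entries that are ignored, and for each [j] eight
   entries, four for the coefficient of [u] and four for that of [v], where
   [a; b; c; d] means [(a - b) + i (c - d)].  The vector [al u + (be - ga) v]
   then has the coefficients below, without subtraction. *)
Definition comb_coef (w al be ga k k' k'' : nat) : nat :=
  (al * code_nth w k + be * code_nth w k' + ga * code_nth w k'')%N.

(** Swapping the two entries of a difference negates it, so the weight [ga] is paired with the
    swapped entries of the second vector. The shift to [8 * j.+1] skips the eight parameters at the
    start of the witness. *)
Definition comb_entry (w al be ga j : nat) : nat :=
  let k := (8 * j.+1)%N in
  CodeSeq.code
    [:: CodeSeq.code [:: comb_coef w al be ga k (k + 4) (k + 5);
                         comb_coef w al be ga (k + 1) (k + 5) (k + 4);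
                         code_nth w 1];
        CodeSeq.code [:: comb_coef w al be ga (k + 2) (k + 6) (k + 7);
                         comb_coef w al be ga (k + 3) (k + 7) (k + 6);
                         code_nth w 1]].

Definition comb_code (w al be ga : nat) : nat :=
  CodeSeq.code (mkseq (comb_entry w al be ga) (code_nth w 0)).

Section Vectors.
Variables (R : realType) (F : scalar_field) (V : normedModType (scalars R F)).
Local Notation K := (scalars R F).
Variable v : nat -> V.

Definition gaussian_vector (n m : nat) (c : nat -> nat) (off : nat) : V :=
  \sum_(j < n) (gaussian R F (c (8 * j.+1 + off)%N) (c (8 * j.+1 + off).+1)
     (c (8 * j.+1 + off).+2) (c (8 * j.+1 + off).+3) / m.+1%:R) *: v j.

Definition witness_vector (w off : nat) : V :=
  gaussian_vector (code_nth w 0) (code_nth w 1) (code_nth w) off.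

Lemma rational_vector_comb w al be ga :
  rational_vector v (comb_code w al be ga) =
  al%:R *: witness_vector w 0 + (be%:R - ga%:R) *: witness_vector w 4.
Proof.
rewrite /rational_vector /comb_code CodeSeq.codeK size_mkseq.
rewrite /witness_vector /gaussian_vector !scaler_sumr -big_split /=.
apply: eq_bigr => j _; rewrite nth_mkseq// /comb_entry scalar_of_code_gaussian.
rewrite !scalerA -scalerDl; congr (_ *: _).
rewrite !mulrA -mulrDl; congr (_ / _).
rewrite /gaussian /comb_coef !addn0 -!addnS !natrD !natrM.
rewrite addn1 addn2 addn3; ring.
Qed.

Lemma eq_gaussian_vector n m c c' off : (off <= 4)%N ->
  (forall i, (8 <= i < 8 * n.+1)%N -> c i = c' i) ->
  gaussian_vector n m c off = gaussian_vector n m c' off.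
Proof.
move=> o4 cc; apply: eq_bigr => j _; have := ltn_ord j => jn.
by rewrite !cc//; lia.
Qed.

(** The approximation persists for all larger lengths and denominators, so that two vectors can be
    approximated with the same [n] and the same [m]. *)
Lemma gaussian_vector_dense (x : V) (e : R) : presentation v -> 0 < e ->
  exists n0, forall n, (n0 <= n)%N -> exists m0, forall m, (m0 <= m)%N ->
    exists c : nat -> nat * nat * nat * nat,
    rnorm (x - \sum_(j < n) (gaussian R F (c j).1.1.1 (c j).1.1.2
      (c j).1.2 (c j).2 / m.+1%:R) *: v j) < e.
Proof.
move=> dv e0.
have e20 : 0 < of_real F (e / 2).
  rewrite lt_neqAle -{2}(of_real0 R F) ler_of_real divr_ge0 ?ltW// andbT.
  apply/negP => /eqP; rewrite -(of_real0 R F) => /of_real_inj /eqP.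
  by rewrite eq_sym gt_eqF ?divr_gt0.
have Bx : ball x (of_real F (e / 2)) !=set0 by exists x; exact: ballxx.
have [y [/= xy [n0 [a yE]]]] := dv _ Bx (ball_open _ _).
exists n0 => n n0n.
pose a' (j : nat) : K := if insub j is Some i then a i else 0.
have {}yE : y = \sum_(j < n) a' j *: v j.
  rewrite yE -(big_mkord xpredT (fun j => a' j *: v j)) (big_cat_nat (leq0n n0) n0n)//=.
  rewrite [X in _ + X]big_nat_cond [X in _ + X]big1 ?addr0; last first.
    move=> j /andP[/andP[j0 _] _]; rewrite /a' insubN ?scale0r// -leqNgt//.
  by rewrite big_mkord; apply: eq_bigr => j _; rewrite /a' valK.
pose B := \sum_(j < n) rnorm (v j).
have B0 : 0 <= B by apply: sumr_ge0 => j _; exact: rnorm_ge0.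
exists (Num.truncn (2 * B / (e / 2))) => m mB.
have /choice[c hc] := fun j : nat => gaussian_approx (a' j) m.
exists c.
rewrite -[x - _](subrKA y) addrC; apply: le_lt_trans (rnormD _ _) _.
have xy' : rnorm (x - y) < e / 2.
  move: xy; rewrite -ball_normE /ball_/= -of_real_rnorm.
  by rewrite !lt_neqAle ler_of_real => /andP[h ->]; rewrite andbT; apply: contra h => /eqP ->.
suff : rnorm (y - \sum_(j < n) (gaussian R F (c j).1.1.1 (c j).1.1.2
      (c j).1.2 (c j).2 / m.+1%:R) *: v j) <= e / 2 by lra.
rewrite yE -sumrB.
have m0 : 0 < m.+1%:R :> R by rewrite ltr0n.
apply: (@le_trans _ _ (\sum_(j < n) 2 / m.+1%:R * rnorm (v j))).
  elim/big_rec2: _ => [|j z y' _ IH]; first by rewrite /rnorm normr0 /sRe; case: F.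
  apply: le_trans (rnormD _ _) _; apply: lerD => //.
  by rewrite -scalerBl rnormZ ler_wpM2r ?rnorm_ge0.
rewrite -mulr_sumr -/B mulrAC ler_pdivrMr// [leRHS]mulrC -ler_pdivrMr ?divr_gt0//.
apply: ltW; apply: lt_le_trans (truncnS_gt _) _.
by rewrite ler_nat ltnS.
Qed.

Lemma gaussian_vector_dense2 (x y : V) (e : R) : presentation v -> 0 < e ->
  exists n m c, rnorm (x - gaussian_vector n m c 0) < e /\
                rnorm (y - gaussian_vector n m c 4) < e.
Proof.
move=> dv e0.
have [n1 h1] := gaussian_vector_dense x dv e0.
have [n2 h2] := gaussian_vector_dense y dv e0.
pose n := maxn n1 n2.
have [m1 {}h1] := h1 n (leq_maxl _ _); have [m2 {}h2] := h2 n (leq_maxr _ _).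
pose m := maxn m1 m2.
have [c1 {}h1] := h1 m (leq_maxl _ _); have [c2 {}h2] := h2 m (leq_maxr _ _).
pose f j r : nat := nth 0%N [:: (c1 j).1.1.1; (c1 j).1.1.2; (c1 j).1.2; (c1 j).2;
  (c2 j).1.1.1; (c2 j).1.1.2; (c2 j).1.2; (c2 j).2] r.
(* The predecessor undoes the shift by one block of eight that is reserved for the parameters. *)
pose c i := f (i %/ 8)%N.-1 (i %% 8)%N.
have cE j r : (r < 8)%N -> c (8 * j.+1 + r)%N = f j r.
  by move=> r8; rewrite /c mulnC modnMDl divnMDl// modn_small// divn_small// addn0.
exists n, m, c; split.
- apply: le_lt_trans h1; rewrite le_eqVlt; apply/orP; left; apply/eqP.
  by congr (rnorm (x - _)); apply: eq_bigr => j _; rewrite -!addnS !cE.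
- apply: le_lt_trans h2; rewrite le_eqVlt; apply/orP; left; apply/eqP.
  by congr (rnorm (y - _)); apply: eq_bigr => j _; rewrite -!addnS !cE.
Qed.

End Vectors.

Local Open Scope nat_scope.

(** * The search procedure *)

Section RecursiveTests.
Variable n : nat.
Implicit Types f g : n.-tuple nat -> nat.

Lemma recursive_leq f g :
  recursive f -> recursive g -> recursive (fun x => (f x <= g x) : nat).
Proof.
move=> rf rg; have := recursive_sub (recursive_const n 1) (recursive_sub rf rg).
by apply: eq_recursive => x; rewrite /leq; case: (f x - g x).
Qed.

Lemma recursive_andb (a b : n.-tuple nat -> bool) :
  recursive (fun x => a x : nat) -> recursive (fun x => b x : nat) ->
  recursive (fun x => (a x && b x) : nat).
Proof.
move=> ra rb; have := recursive_mul ra rb.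
by apply: eq_recursive => x; rewrite mulnb.
Qed.

End RecursiveTests.

Ltac recursive_tac := repeat first
  [ recursive_leaf | apply: recursive_andb | apply: recursive_leq
  | apply: recursive_code_nth | apply: recursive_code_cons
  | apply: recursive_S | apply: recursive_add | apply: recursive_mul
  | apply: recursive_sub | apply: recursive_exp | apply: recursive_divn ].

Lemma recursive_comb_code n (w al be ga : n.-tuple nat -> nat) :
  recursive w -> recursive al -> recursive be -> recursive ga ->
  recursive (fun x => comb_code (w x) (al x) (be x) (ga x)).
Proof.
move=> rw ra rb rg.
apply: (recursive_code_mkseq (h := fun j x => comb_entry (w x) (al x) (be x) (ga x) j)).
  by recursive_tac.
have rw' := recursive_behead rw; have ra' := recursive_behead ra.
have rb' := recursive_behead rb; have rg' := recursive_behead rg.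
rewrite /comb_entry /comb_coef.
by recursive_tac.
Qed.

(** The integer part of [2 ^ J] times the rational named by [q J x]. A negative rational is replaced
    by [0], which does not harm an approximation of a norm. *)
Definition norm_floor (q : nat -> nat -> nat) (J x : nat) : nat :=
  ((code_nth (q J x) 0 - code_nth (q J x) 1) * 2 ^ J) %/ (code_nth (q J x) 2).+1.

(** Everything that has to be guessed, the two vectors, [n], [N], the precision and [a], is packed
    into [w], so that one unbounded search suffices; [P] and [q] are fixed beforehand. *)
Definition witness_test (q : nat -> nat -> nat) (P k w : nat) : bool :=
  let nu al be ga := norm_floor q (code_nth w 2) (comb_code w al be ga) in
  let N := (code_nth w 4).+1 in
  accepts P (2 ^ k) (2 ^ code_nth w 2) (code_nth w 3).+1 N (code_nth w 5)
    (nu 1 0 0) (nu 0 1 0) (nu N 1 0) (nu N 0 1) (nu 1 1 0) (nu 1 0 1).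

Lemma recursive_norm_floor n (q : nat -> nat -> nat) (J x : n.-tuple nat -> nat) :
  computable2 q -> recursive J -> recursive x ->
  recursive (fun y => norm_floor q (J y) (x y)).
Proof.
move=> rq rJ rx; have rqJ := recursive_comp2 rq rJ rx.
by rewrite /norm_floor; recursive_tac.
Qed.

Lemma recursive_witness_test n q P (k w : n.-tuple nat -> nat) :
  computable2 q -> recursive k -> recursive w ->
  recursive (fun x => witness_test q P (k x) (w x) : nat).
Proof.
move=> rq rk rw.
pose N x := (code_nth (w x) 4).+1.
have rN : recursive N by rewrite /N; recursive_tac.
have rJ : recursive (fun x => code_nth (w x) 2) by recursive_tac.
have rnu al be ga : recursive al -> recursive be -> recursive ga ->
    recursive (fun x => norm_floor q (code_nth (w x) 2)
                          (comb_code (w x) (al x) (be x) (ga x))).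
  by move=> ra rb rg; apply: recursive_norm_floor => //; exact: recursive_comb_code.
have r0 := recursive_const n 0; have r1 := recursive_const n 1.
have R1 := rnu _ _ _ r1 r0 r0.
have R2 := rnu _ _ _ r0 r1 r0.
have R3 := rnu _ _ _ rN r1 r0.
have R4 := rnu _ _ _ rN r0 r1.
have R5 := rnu _ _ _ r1 r1 r0.
have R6 := rnu _ _ _ r1 r0 r1.
rewrite /witness_test /accepts.
by recursive_tac.
Qed.

Lemma computable_search (t : nat -> nat -> bool) :
  (forall k, exists w, t k w) ->
  recursive (fun y : 2.-tuple nat => t (tnth y ord_max) (tnth y ord0) : nat) ->
  exists2 g, computable1 g & forall k, t k (g k).
Proof.
move=> ext rt; exists (fun k => ex_minn (ext k)); last first.
  by move=> k; case: ex_minnP.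
apply: (recursive_argmin (f := fun w x => 1 - t (thead x) w)).
- by move=> x; rewrite /thead; case: ex_minnP => w ->.
- move=> x w; rewrite /thead; case: ex_minnP => m _ hm h.
  by apply: hm; move: h; case: (t _ w).
have := recursive_sub (recursive_const 2 1) rt.
apply: eq_recursive => y; congr (_ - _); congr (nat_of_bool (t _ _)).
by rewrite /thead tnth_behead; congr tnth; apply: val_inj; rewrite /= inordK.
Qed.

Local Open Scope ring_scope.

(** One unit of the error [2] comes from the approximation, [2 ^ J] times [2 ^- J], and one from
    rounding down. *)
Lemma norm_floor_bounds (R : realType) (q : nat -> nat -> nat) (J x : nat) (r : R) :
  0 <= r -> `|ratr (rat_of_code (q J x)) - r| < 2 ^- J ->
  (norm_floor q J x)%:R - 2 <= (2 ^ J)%:R * r <= (norm_floor q J x)%:R + 2.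
Proof.
move=> r0; rewrite /norm_floor /rat_of_code -/(code_nth _ 0) -/(code_nth _ 1) -/(code_nth _ 2).
set A := code_nth _ 0; set B := code_nth _ 1; set C := code_nth _ 2.
have -> : ratr ((A%:Z - B%:Z)%:Q / C.+1%:R) = (A%:R - B%:R) / C.+1%:R :> R.
  by rewrite fmorph_div/= ratr_int ratr_nat intrB.
rewrite -natrX; set D := (2 ^ J)%N.
have D0 : 0 < D%:R :> R by rewrite ltr0n expn_gt0.
have C0 : 0 < C.+1%:R :> R by rewrite ltr0n.
set rho := _ / _ => h.
have {h} : -1 < D%:R * rho - D%:R * r < 1.
  move: h; rewrite ltr_norml => /andP[h1 h2].
  move: h1 h2; rewrite -(ltr_pM2l D0) mulrN mulfV ?gt_eqF// mulrBr => ->.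
  by rewrite -(ltr_pM2l D0) mulfV ?gt_eqF// mulrBr => ->.
have Dr0 : 0 <= D%:R * r by rewrite mulr_ge0// ltW.
have [AB|BA] := leqP A B.
  have rho0 : D%:R * rho <= 0.
    rewrite pmulr_rle0// /rho mulr_le0_ge0 ?invr_ge0 ?(ltW C0)//.
    by rewrite subr_le0 ler_nat.
  by rewrite (eqP AB) mul0n div0n => /andP[h1 h2]; apply/andP; split; lra.
set nu := (_ %/ _)%N.
have E : D%:R * rho * C.+1%:R = ((A - B) * D)%:R.
  by rewrite natrM natrB ?(ltnW BA)// /rho -mulrA divfK ?gt_eqF// mulrC.
have nu1 : nu%:R <= D%:R * rho.
  by rewrite -(ler_pM2r C0) E -natrM ler_nat leq_trunc_div.
have nu2 : D%:R * rho < nu%:R + 1.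
  by rewrite -(ltr_pM2r C0) E natr1 -natrM ltr_nat ltn_ceil.
by move=> /andP[h1 h2]; apply/andP; split; lra.
Qed.

(** * The exponent computed from a presentation, in any normed space with the two inequalities *)

Section ComputableExponent.
Variables (R : realType) (F : scalar_field) (V : normedModType (scalars R F)).
Variables (p : R) (P : nat) (v : nat -> V) (q : nat -> nat -> nat).
Local Notation K := (scalars R F).
Hypotheses (p2 : 2 < p) (pP : p <= P%:R).
Hypothesis clarkson : forall x y : V,
  2 * (rnorm x `^ p + rnorm y `^ p) <= rnorm (x + y) `^ p + rnorm (x - y) `^ p.
Hypothesis second : forall (n P : nat) (c : R) (t : K) (x y : V),
  (0 < n)%N -> p <= P%:R -> c = (n.+1 ^ (P + 2))%:R ->
  modulus t ^+ 2 * rnorm (x + y) `^ p + c * rnorm x `^ p <=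
  modulus t ^+ 2 * ((1 + n%:R^-1) `^ p * (rnorm x `^ p + rnorm y `^ p)) +
  c / 2 * (rnorm (x + t *: y) `^ p + rnorm (x - t *: y) `^ p).
Hypothesis basis : exists u v : V,
  rnorm v = 1 /\ forall t : K, rnorm (u + t *: v) `^ p = 1 + modulus t `^ p.
Hypothesis dense_v : presentation v.
Hypothesis q_approx : forall k m : nat,
  `|ratr (rat_of_code (q k m)) - rnorm (rational_vector v m)| < 2 ^- k.

Let nu (w : nat) (al be ga : nat) :=
  norm_floor q (code_nth w 2) (comb_code w al be ga).

Lemma nu_bounds w al be ga :
  let r := rnorm (al%:R *: witness_vector v w 0 +
                  (be%:R - ga%:R) *: witness_vector v w 4) in
  (nu w al be ga)%:R - 2 <= (2 ^ code_nth w 2)%:R * r <= (nu w al be ga)%:R + 2.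
Proof.
rewrite -rational_vector_comb; apply: norm_floor_bounds => //.
exact: rnorm_ge0.
Qed.

Lemma modulus_natV (N : nat) : modulus (N%:R^-1 : K) = N%:R^-1.
Proof.
apply: (@of_real_inj R F); rewrite of_real_modulus ger0_norm//.
by rewrite /of_real; case: F => //=; rewrite fmorphV rmorph_nat.
Qed.

Lemma modulus_nat (N : nat) : modulus (N%:R : K) = N%:R.
Proof.
apply: (@of_real_inj R F); rewrite of_real_modulus ger0_norm//.
by rewrite /of_real; case: F => //=; rewrite rmorph_nat.
Qed.

Lemma witness_test_sound k w : witness_test q P k w ->
  (code_nth w 5)%:R < p * (2 ^ k)%:R < (code_nth w 5 + 2)%:R.
Proof.
pose U := witness_vector v w 0; pose W := witness_vector v w 4.
pose n := (code_nth w 3).+1; pose N := (code_nth w 4).+1.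
have N0 : N%:R != 0 :> K by rewrite pnatr_eq0.
have p2' := ltW p2.
apply: (@accepts_sound R p p2' P (2 ^ k) (2 ^ code_nth w 2) n N (code_nth w 5)
  _ _ _ _ _ _ (rnorm U) (rnorm W) (rnorm (N%:R *: U + W))
  (rnorm (N%:R *: U - W)) (rnorm (U + W)) (rnorm (U - W))) => //.
- by rewrite expn_gt0.
- by move=> i; rewrite (tnth_nth 0); case: i => [[|[|[|[|[|[|?]]]]]] ?] //=; exact: rnorm_ge0.
- have B al be ga := nu_bounds w al be ga.
  have B1 := B 1%N 0%N 0%N; have B2 := B 0%N 1%N 0%N.
  have B3 := B N 1%N 0%N; have B4 := B N 0%N 1%N.
  have B5 := B 1%N 1%N 0%N; have B6 := B 1%N 0%N 1%N.
  rewrite /= !subr0 !scale1r ?scale0r ?addr0 ?add0r in B1 B2 B3 B5.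
  rewrite /= sub0r scaleN1r ?scale1r in B4 B6.
  move=> i; rewrite !(tnth_nth 0).
  case: i => [[|[|[|[|[|[|?]]]]]] ?] /=; [exact: B1|exact: B2|exact: B3|
    exact: B4|exact: B5|exact: B6|by []].
(* The test evaluates [N U + W] and [N U - W] so that coefficients stay integral; homogeneity brings
   them back to [U + W / N] and [U - W / N]. *)
- move=> c cE; have := second (N%:R^-1) U W (isT : (0 < n)%N) pP cE.
  have ZE (s : V) : N%:R *: (U + N%:R^-1 *: s) = N%:R *: U + s.
    by rewrite scalerDr scalerA mulfV// scale1r.
  have rE (s : V) : rnorm (U + N%:R^-1 *: s) = N%:R^-1 * rnorm (N%:R *: U + s).
    rewrite -ZE rnormZ modulus_nat mulrA mulVf ?mul1r//.
    by rewrite pnatr_eq0.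
  by rewrite -scalerN !rE modulus_natV.
Qed.

Lemma modulus_of_real (x : R) : 0 <= x -> modulus (of_real F x) = x.
Proof. by move=> x0; rewrite modulus_real ger0_norm. Qed.

Lemma rnorm_perturb (x y x' y' : V) (al be : K) (e : R) :
  rnorm (x - x') <= e -> rnorm (y - y') <= e ->
  `|rnorm (al *: x' + be *: y') - rnorm (al *: x + be *: y)| <=
  (modulus al + modulus be) * e.
Proof.
move=> xx yy.
have S (z1 z2 z1' z2' : V) : rnorm (al *: (z1 - z1') + be *: (z2 - z2')) <=
    modulus al * rnorm (z1 - z1') + modulus be * rnorm (z2 - z2').
  by apply: le_trans (rnormD _ _) _; rewrite !rnormZ.
have le_e : modulus al * rnorm (x - x') + modulus be * rnorm (y - y') <=
    (modulus al + modulus be) * e.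
  by rewrite mulrDl lerD// ler_wpM2l ?modulus_ge0.
have E (z1 z2 z1' z2' : V) : al *: (z1 - z1') + be *: (z2 - z2') =
    (al *: z1 + be *: z2) - (al *: z1' + be *: z2').
  by rewrite !scalerBr opprD addrACA.
rewrite ler_norml; apply/andP; split.
  rewrite lerNl opprB; apply: le_trans _ le_e; apply: le_trans _ (S _ _ _ _).
  by rewrite E rnormB.
apply: le_trans _ le_e; rewrite -(rnormN (x - x')) -(rnormN (y - y')) !opprB.
by apply: le_trans _ (S _ _ _ _); rewrite E rnormB.
Qed.

Lemma witness_exists k : exists w, witness_test q P k w.
Proof.
have p0 : 0 < p by apply: lt_trans p2.
have [u0 [v0 [v01 uv]]] := basis.
have b0 : (0 < 2 ^ k)%N by rewrite expn_gt0.
have [a [n [N [J [n0 N0 acc]]]]] := accepts_complete p2 pP b0.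
set g := 2 `^ p^-1 in acc.
have D0 : 0 < (2 ^ J)%:R :> R by rewrite ltr0n expn_gt0.
set D := (2 ^ J)%:R : R in D0.
have N0' : 1 <= N%:R :> R by rewrite ler1n.
(* Approximations of unit vectors could fall short of the required [D + 2]. Scaling the pair adds
   [10] to the scaled norms of [u0] and [v0], against an error of at most [3], which places them
   between [D + 7] and [D + 13]. *)
pose c : R := 1 + 10 / D.
have c0 : 0 <= c by rewrite addr_ge0// divr_ge0// ltW.
have Dc : D * c = D + 10 by rewrite mulrDr mulr1 mulrCA mulfV ?gt_eqF// mulr1.
have e0 : 0 < D^-1 by rewrite invr_gt0.
have [n1 [m1 [cf [hU hV]]]] :=
  gaussian_vector_dense2 (of_real F c *: u0) (of_real F c *: v0) dense_v e0.
pose e i := if (i < 8)%N then nth 0%N [:: n1; m1; J; n.-1; N.-1; a] i else cf i.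
pose w := CodeSeq.code (mkseq e (8 * n1.+1)).
have wE i : (i < 8 * n1.+1)%N -> code_nth w i = e i.
  by move=> ?; rewrite /code_nth CodeSeq.codeK nth_mkseq.
have ws i : (i < 8)%N -> code_nth w i = nth 0%N [:: n1; m1; J; n.-1; N.-1; a] i.
  by move=> i8; rewrite wE /e ?i8// mulnS ltn_addr.
have wV off : (off <= 4)%N -> witness_vector v w off = gaussian_vector v n1 m1 cf off.
  move=> off4; rewrite /witness_vector !ws//=; apply: eq_gaussian_vector => // i.
  by move=> /andP[i8 i1]; rewrite wE// /e ltnNge i8.
have rp (r s : R) : 0 <= r -> r `^ p = s -> r = s `^ p^-1.
  by move=> r0 <-; rewrite -powRrM mulfV ?gt_eqF// powRr1.
have g2 : g <= 2.
  rewrite -[leRHS]powRr1// ler_powR ?ler1n// invf_le1//.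
  by apply: ltW; apply: lt_trans p2; rewrite ltr1n.
have g1 : 1 <= g by rewrite -(powRr0 2) ler_powR ?ler1n// invr_ge0 ltW.
(* The term [10 r] comes from the factor [c], [al + m'] from approximating both vectors within
   [1 / D], and [2] from rounding. As [g] and [X] are at most [2], the total stays within the
   constant [26] of [accepts_complete]. *)
have bounds al be ga r m' : modulus (be%:R - ga%:R : K) = m' ->
    rnorm (al%:R *: u0 + (be%:R - ga%:R) *: v0) = r ->
    D * r + 10 * r - al%:R - m' - 2 <= (nu w al be ga)%:R <=
    D * r + 10 * r + al%:R + m' + 2.
  move=> mE rE.
  have := nu_bounds w al be ga; rewrite /= !wV// ws//= -/D.
  have := rnorm_perturb (al%:R) (be%:R - ga%:R) (ltW hU) (ltW hV).
  have -> : al%:R *: (of_real F c *: u0) + (be%:R - ga%:R) *: (of_real F c *: v0) =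
      of_real F c *: (al%:R *: u0 + (be%:R - ga%:R) *: v0).
    by rewrite scalerDr !scalerA; congr (_ *: _ + _ *: _); rewrite mulrC.
  rewrite rnormZ modulus_of_real// rE modulus_nat mE.
  set s := rnorm _.
  rewrite -(ler_pM2l D0) mulrCA mulfV ?gt_eqF// mulr1.
  rewrite -[D in D * `|_|](gtr0_norm D0) -normrM mulrBr mulrA Dc mulrDl.
  by rewrite ler_norml => /andP[h1 h2] /andP[h3 h4]; apply/andP; split; lra.
have mod0E : modulus (0%:R - 0%:R : K) = 0 by rewrite subr0 modulus0.
have mod1E : modulus (1%:R - 0%:R : K) = 1 by rewrite subr0 (modulus_nat 1).
have modN1E : modulus (0%:R - 1%:R : K) = 1 by rewrite sub0r modulusN (modulus_nat 1).
have u01 : rnorm u0 = 1.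
  have := uv 0; rewrite scale0r addr0 modulus0 powR0 ?gt_eqF// addr0.
  by move=> /(rp _ _ (rnorm_ge0 _)) ->; rewrite powR1.
pose X := (1 + N%:R^-1 `^ p) `^ p^-1.
have X2 : X <= 2.
  apply: le_trans g2; rewrite ge0_ler_powR ?nnegrE ?invr_ge0 ?addr_ge0 ?powR_ge0 ?(ltW p0)//.
  have : N%:R^-1 `^ p <= 1 `^ p.
    rewrite ge0_ler_powR ?nnegrE ?invr_ge0 ?(ltW p0)//.
    by rewrite invf_le1 ?ltr0n.
  rewrite powR1. lra.
have rN (t : K) : modulus t = 1 -> rnorm (N%:R *: u0 + t *: v0) = N%:R * X.
  move=> t1; have -> : N%:R *: u0 + t *: v0 = N%:R *: (u0 + (N%:R^-1 * t) *: v0).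
    by rewrite scalerDr scalerA mulrA mulfV ?mul1r// pnatr_eq0 -lt0n.
  rewrite rnormZ modulus_nat; congr (_ * _); apply: rp; first exact: rnorm_ge0.
  by rewrite uv modulusM modulus_natV t1 mulr1.
have r1 (t : K) : modulus t = 1 -> rnorm (1%:R *: u0 + t *: v0) = g.
  move=> t1; rewrite scale1r; apply: rp; first exact: rnorm_ge0.
  by rewrite uv t1 powR1.
have B1 := bounds 1%N 0%N 0%N 1 _ mod0E.
have B2 := bounds 0%N 1%N 0%N 1 _ mod1E.
rewrite !subr0 !scale0r ?addr0 ?add0r ?scale1r in B1 B2.
have {}B1 := B1 u01; have {}B2 := B2 v01.
have B3 := bounds N 1%N 0%N _ _ mod1E (rN _ mod1E).
have B4 := bounds N 0%N 1%N _ _ modN1E (rN _ modN1E).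
have B5 := bounds 1%N 1%N 0%N _ _ mod1E (r1 _ mod1E).
have B6 := bounds 1%N 0%N 1%N _ _ modN1E (r1 _ modN1E).
have NX : N%:R * X <= N%:R * 2 by rewrite ler_wpM2l.
exists w; rewrite /witness_test !ws//= !prednK//.
have nuE al be ga : norm_floor q J (comb_code w al be ga) = nu w al be ga.
  by rewrite /nu ws.
rewrite !nuE; apply: acc (leqnn J) _ _ _ _ _ _ _; rewrite -/D -/X.
- move: B1 => /andP[h1 h2]; rewrite -!(ler_nat R) !natrD -/D; apply/andP; split; lra.
- move: B2 => /andP[h1 h2]; rewrite -!(ler_nat R) !natrD -/D; apply/andP; split; lra.
- move: B3 => /andP[h1 h2]; rewrite natrD; lra.
- move: B4 => /andP[h1 h2]; rewrite natrD; lra.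
- move: B5 => /andP[h1 h2]; rewrite natrD; lra.
- move: B6 => /andP[h1 h2]; rewrite natrD; lra.
- move: B5 => /andP[h1 h2]; lra.
Qed.

Lemma computable_exponent : computable2 q -> computable_real p.
Proof.
move=> rq.
have rt : recursive (fun y : 2.-tuple nat =>
    witness_test q P (tnth y ord_max) (tnth y ord0) : nat).
  by apply: recursive_witness_test => //; exact: recursive_proj.
have [g rg tg] := computable_search witness_exists rt.
(* The midpoint [(a + 1) / 2 ^ k] of the interval found; the third entry of a name is the
   denominator minus [1]. *)
exists (fun k => CodeSeq.code [:: (code_nth (g k) 5).+1; 0%N; (2 ^ k).-1]).
  rewrite /computable1; cbv beta.
  have rk : recursive (fun x : 1.-tuple nat => tnth x ord0) by exact: recursive_proj.
  have rg' : recursive (fun x : 1.-tuple nat => g (tnth x ord0)) by [].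
  apply: recursive_code_cons; first by recursive_tac.
  apply: recursive_code_cons; first by recursive_tac.
  apply: recursive_code_cons; last exact: recursive_const.
  by apply: recursive_pred; recursive_tac.
move=> k; have /andP[h1 h2] := witness_test_sound (tg k).
rewrite /rat_of_code CodeSeq.codeK /= prednK ?expn_gt0//.
rewrite fmorph_div/= ratr_int ratr_nat subr0 -natrX.
set b := (2 ^ k)%N in h1 h2 *.
have b0 : 0 < b%:R :> R by rewrite ltr0n expn_gt0.
rewrite -(ltr_pM2l b0) mulfV ?gt_eqF// -{1}(gtr0_norm b0) -normrM mulrBr.
rewrite [b%:R * (_ / _)]mulrC divfK ?gt_eqF// ltr_norml.
move: h1 h2; rewrite natrD -[_.+1%:R]natr1 (mulrC b%:R p) => h1 h2.
by apply/andP; split; lra.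
Qed.

End ComputableExponent.

Lemma computable_real2 (R : realType) : computable_real (2 : R).
Proof.
exists (fun=> CodeSeq.code [:: 2; 0; 0]); first exact: recursive_const.
move=> k; rewrite /rat_of_code CodeSeq.codeK /= subr0 divr1 ratr_int.
by rewrite subrr normr0 invr_gt0 exprn_gt0.
Qed.

Lemma ler_dist_of_real (R : realType) (F : scalar_field) (x : rat) (r : R) k :
  `|ratr x - of_real F r| < 2 ^- k -> `|ratr x - r| < 2 ^- k.
Proof.
case: F => //=.
have -> : ratr x = (ratr x)%:C%C :> R[i] by rewrite (fmorph_rat (real_complex R)).
rewrite -rmorphB normc_def /= expr0n addr0 sqrtr_sqr.
have -> : 2 ^- k = (2 ^- k)%:C%C :> R[i] by rewrite fmorphV rmorphXn rmorph_nat.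
by rewrite ltcR.
Qed.

Theorem theorem4p1 (R : realType) (F : scalar_field) (p : R) (p2 : 2 <= p) :
  (exists (d : measure_display) (T : measurableType d)
          (mu : {measure set T -> \bar R}),
     dim_ge2 (Lp F mu (ge2_ge1 p2)) /\
     exists v : nat -> Lp F mu (ge2_ge1 p2), computable_presentation v) ->
  computable_real p.
Proof.
move=> [d [T [mu [dim [v [dv [q rq qv]]]]]]].
(* This distinction and the choice of an integer above [p] are not effective, but only the existence
   of an algorithm is claimed. *)
have [p2'|] := boolP (2 < p); last first.
  rewrite -leNgt => ple2; have -> : p = 2 by apply/eqP; rewrite eq_le ple2.
  exact: computable_real2.
apply: (@computable_exponent R F _ p (Num.truncn p).+1 v q) => //.
- exact/ltW/truncnS_gt.
- exact: Lp_clarkson.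
- exact: Lp_second_difference.
- exact: dim_ge2_lp2_pair.
- by move=> k m; apply: (@ler_dist_of_real R F); rewrite of_real_rnorm; exact: qv.
Qed.
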